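(* Let $\mathbb{G}$ be an orientation preserving self-affine carpet with attractor $\Lambda$ such that at least one of the following holds: (a) both projected IFSs $\mathrm{p}_1\mathbb{G}$ and $\mathrm{p}_2\mathbb{G}$ satisfy the weak separation condition; or (b) $\mathbb{G}$ satisfies coordinate ordering and the rectangular open set condition, and $\mathrm{p}_2\mathbb{G}$ satisfies the weak separation condition. Then $$\dim_{\mathrm H}(\Lambda)=\lim_{n\to\infty}\mathbb{H}_{BA}(\mathbb{G}_n),$$ where $\mathbb{G}_n$ is the set of $n$-fold compositions of the functions of $\mathbb{G}$.
   Context: A self-affine carpet is a finite set $\mathbb{G}$ of maps $S(x,y)=(r_{S,1}x+t_{S,1},\,r_{S,2}y+t_{S,2})$ of $\mathbb{R}^2$ with $|r_{S,\ell}|\in(0,1)$ for all $S\in\mathbb{G}$, $\ell\in\{1,2\}$. Its attractor $\Lambda$ is the unique non-empty compact set with $\Lambda=\bigcup_{S\in\mathbb{G}}S(\Lambda)$. Write $\mathrm{p}_1(x,y)=x$, $\mathrm{p}_2(x,y)=y$, and for a map $S$ of the form $S(x,y)=(r_{S,1}x+t_{S,1},\,r_{S,2}y+t_{S,2})$ with $|r_{S,\ell}|\in(0,1)$ let $\mathrm{p}_\ell S$ be the map $u\mapsto r_{S,\ell}u+t_{S,\ell}$ of $\mathbb{R}$. For a finite set $\mathbb{F}$ of such maps, $\mathrm{p}_\ell\mathbb{F}=\{\mathrm{p}_\ell S: S\in\mathbb{F}\}$ (as a set, without multiplicity); $\mathrm{p}_\ell\mathbb{G}$ is a self-similar IFS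 on $\mathbb{R}$ with attractor $\mathrm{p}_\ell\Lambda$. Standing assumption: $\mathrm{conv}(\mathrm{p}_1\Lambda)\times\mathrm{conv}(\mathrm{p}_2\Lambda)=[0,1]^2$. $\mathbb{G}_n=\{S_1\circ\dots\circ S_n: S_i\in\mathbb{G}\}$ as a set of maps (again of the form $S(x,y)=(r_{S,1}x+t_{S,1},\,r_{S,2}y+t_{S,2})$ with $|r_{S,\ell}|\in(0,1)$). Orientation preserving: $r_{S,1},r_{S,2}>0$ for all $S\in\mathbb{G}$. Coordinate ordering: $|r_{S,1}|\le|r_{S,2}|$ for all $S\in\mathbb{G}$. Rectangular open set condition: $S((0,1)^2)\cap\hat S((0,1)^2)=\emptyset$ for all $S\ne\hat S\in\mathbb{G}$. A self-similar IFS $\mathbb{F}$ satisfies the weak separation condition if the identity map is an isolated point of $\{S^{-1}\circ\hat S: S,\hat S\in\mathbb{F}^*\}$, where $\mathbb{F}^*$ is the set of all finite compositions (of length $\geq 1$) of maps of $\mathbb{F}$. For a finite set $\mathbb{F}$ of maps of the form $S(x,y)=(r_{S,1}x+t_{S,1},\,r_{S,2}y+t_{S,2})$ with $r_{S,\ell}\in(0,1)$, let $P(\mathbb{F})$ be the set of probability vectors $p=(p_S)_{S\in\mathbb{F}}$, and for $R\in\mathrm{p}_\ell\mathbb{F}$ put $q^\ell_R=\sum_{S\in\mathbb{F}:\,\mathrm{p}_\ell S=R}p_S$. With $0\log0:=0$ define $$D(p,\mathbb{F})=\frac{\sum_{S}p_S\log p_S}{\sum_Sp_S\log r_{S,1}}+\frac{\sum_{R\in\mathrm{p}_2\mathbb{F}}q^2_R\log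 q^2_R}{\sum_Sp_S\log r_{S,2}}-\frac{\sum_{R\in\mathrm{p}_2\mathbb{F}}q^2_R\log q^2_R}{\sum_Sp_S\log r_{S,1}}\quad\text{if }\sum_Sp_S\log\frac{r_{S,2}}{r_{S,1}}\ge0,$$ $$D(p,\mathbb{F})=\frac{\sum_{S}p_S\log p_S}{\sum_Sp_S\log r_{S,2}}+\frac{\sum_{R\in\mathrm{p}_1\mathbb{F}}q^1_R\log q^1_R}{\sum_Sp_S\log r_{S,1}}-\frac{\sum_{R\in\mathrm{p}_1\mathbb{F}}q^1_R\log q^1_R}{\sum_Sp_S\log r_{S,2}}\quad\text{if }\sum_Sp_S\log\frac{r_{S,2}}{r_{S,1}}<0,$$ sums over $S$ being over $S\in\mathbb{F}$, and $\mathbb{H}_{BA}(\mathbb{F})=\max\{D(p,\mathbb{F}):p\in P(\mathbb{F})\}$. *)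

(* Defs.v *)
From HB Require Import structures.
From mathcomp Require Import all_boot all_order all_algebra.
From mathcomp Require Import finmap.
From mathcomp Require Import all_classical all_reals all_analysis.

Set Implicit Arguments.
Unset Strict Implicit.
Unset Printing Implicit Defensive.

Import Order.TTheory GRing.Theory Num.Theory.
Import numFieldNormedType.Exports.

Local Open Scope classical_set_scope.
Local Open Scope ring_scope.

Section affine_maps.
Context {R : realType}.

(* The pair (r, t) encodes the map u |-> r u + t of the line, so that Leibniz
   equality of codes is equality of maps (affine_inj). *)
Definition affine1 (R : realType) : Type := (R * R)%type.

Definition ratio (f : affine1 R) : R := f.1.

Definition affine_eval (f : affine1 R) (u : R) : R := f.1 * u + f.2.

Definition affine_id : affine1 R := (1, 0).

Definition affine_comp (f g : affine1 R) : affine1 R :=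
  (f.1 * g.1, f.1 * g.2 + f.2).

Definition affine_inv (f : affine1 R) : affine1 R := (f.1^-1, - (f.1^-1 * f.2)).

(* A diagonal affine map of the plane is the pair of its coordinate maps: the
   projections p_1 S and p_2 S are S.1 and S.2. *)
Definition diagonal_map (R : realType) : Type := (affine1 R * affine1 R)%type.

Definition diagonal_eval (S : diagonal_map R) (z : R * R) : R * R :=
  (affine_eval S.1 z.1, affine_eval S.2 z.2).

Definition diagonal_id : diagonal_map R := (affine_id, affine_id).

Definition diagonal_comp (S T : diagonal_map R) : diagonal_map R :=
  (affine_comp S.1 T.1, affine_comp S.2 T.2).

End affine_maps.

HB.instance Definition _ (R : realType) :=
  Choice.copy (affine1 R) (R * R)%type.
HB.instance Definition _ (R : realType) :=
  Choice.copy (diagonal_map R) (affine1 R * affine1 R)%type.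

Lemma affine_inj (R : realType) : injective (@affine_eval R).
Proof.
move=> [r t] [r' t'] E.
have E0 := congr1 (fun f => f 0) E; have E1 := congr1 (fun f => f 1) E.
move: E0 E1; rewrite /affine_eval /= !mulr0 !add0r !mulr1 => ->.
by move/addIr => ->.
Qed.

Lemma affine_compE (R : realType) (f g : affine1 R) :
  affine_eval (affine_comp f g) = affine_eval f \o affine_eval g.
Proof.
by apply/funext => u; rewrite /affine_eval /affine_comp /= mulrDr mulrA addrA.
Qed.

Lemma affine_invK (R : realType) (f : affine1 R) : ratio f != 0 ->
  affine_comp (affine_inv f) f = affine_id /\
  affine_comp f (affine_inv f) = affine_id.
Proof.
case: f => r t /= r0; rewrite /affine_comp /affine_id /= mulVf// divff//.
by rewrite subrr mulrN mulrA divff// mul1r addNr.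
Qed.

Lemma diagonal_inj (R : realType) : injective (@diagonal_eval R).
Proof.
move=> [f g] [f' g'] E; congr pair; apply: affine_inj; apply/funext => u.
- by have := congr1 (fun h => (h (u, 0)).1) E.
- by have := congr1 (fun h => (h (0, u)).2) E.
Qed.

Lemma diagonal_compE (R : realType) (S T : diagonal_map R) :
  diagonal_eval (diagonal_comp S T) = diagonal_eval S \o diagonal_eval T.
Proof.
by apply/funext => z; rewrite /diagonal_eval /diagonal_comp /= !affine_compE.
Qed.

(* The set of n-fold compositions; for n = 0 it is {e}. *)
Fixpoint compositions (M : choiceType) (comp : M -> M -> M) (e : M)
    (F : {fset M}) (n : nat) : {fset M} :=
  if n is n'.+1 then
    [fset comp S T | S in F, T in compositions comp e F n']%fset
  else [fset e]%fset.

Lemma compositions1 (M : choiceType) (comp : M -> M -> M) (e : M)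
  (F : {fset M}) : right_id e comp -> compositions comp e F 1 = F.
Proof.
move=> compe; apply/fsetP => x; apply/imfset2P/idP => /=.
- by move=> [y yF [z]]; rewrite inE => /eqP -> ->; rewrite compe.
- by move=> xF; exists x => //; exists e; rewrite ?inE ?compe.
Qed.

Section carpets.
Context {R : realType}.
Implicit Types G : {fset diagonal_map R}.

Definition self_affine_carpet G : Prop :=
  forall S, S \in G ->
    (0 < `|ratio S.1| < 1) /\ (0 < `|ratio S.2| < 1).

Definition is_attractor G (L : set (R * R)) : Prop :=
  [/\ L !=set0, compact L & L = \bigcup_(S in [set` G]) (diagonal_eval S @` L)].

Definition convex_hull (A : set R) : set R := smallest (@convex_set R R^o) A.

Definition normalized (L : set (R * R)) : Prop :=
  convex_hull (fst @` L) `*` convex_hull (snd @` L) = `[0, 1] `*` `[0, 1].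

Definition n_fold G (n : nat) : {fset diagonal_map R} :=
  compositions diagonal_comp diagonal_id G n.

Definition projected1 G : {fset affine1 R} := [fset S.1 | S in G]%fset.

Definition projected2 G : {fset affine1 R} := [fset S.2 | S in G]%fset.

Definition orientation_preserving G : Prop :=
  forall S, S \in G -> 0 < ratio S.1 /\ 0 < ratio S.2.

Definition coordinate_ordering G : Prop :=
  forall S, S \in G -> `|ratio S.1| <= `|ratio S.2|.

Definition rectangular_osc G : Prop :=
  forall S T, S \in G -> T \in G -> S <> T ->
    (diagonal_eval S @` (`]0, 1[ `*` `]0, 1[)) `&`
    (diagonal_eval T @` (`]0, 1[ `*` `]0, 1[)) = set0.

Definition all_compositions (F : {fset affine1 R}) : set (affine1 R) :=
  [set S | exists2 n, (0 < n)%N & S \in compositions affine_comp affine_id F n].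

(* Isolation is in the topology of R * R on the coefficients, which on affine
   maps is the topology of pointwise (or locally uniform) convergence. *)
Definition weak_separation (F : {fset affine1 R}) : Prop :=
  @isolated (R * R)%type
    [set T | exists S S', [/\ all_compositions F S, all_compositions F S' &
                              T = affine_comp (affine_inv S) S']]
    affine_id.

End carpets.

Section ledrappier_young_functional.
Context {R : realType}.
Implicit Types F : {fset diagonal_map R}.

Definition probability_vectors F : set {ffun F -> R} :=
  [set p : {ffun F -> R} | (forall S, 0 <= p S) /\ \sum_S p S = 1].
Arguments probability_vectors : clear implicits.

(* ln 0 = 0, so the convention 0 log 0 = 0 holds. *)
Definition xlogx (x : R) : R := x * ln x.

Definition entropy_sum F (p : {ffun F -> R}) : R := \sum_S xlogx (p S).

Definition marginal F (p : {ffun F -> R}) (pr : diagonal_map R -> affine1 R)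
    (f : affine1 R) : R :=
  \sum_(S : F | pr (val S) == f) p S.

Definition marginal_entropy_sum F (p : {ffun F -> R})
    (pr : diagonal_map R -> affine1 R) : R :=
  \sum_(f <- [fset pr S | S in F]%fset) xlogx (marginal p pr f).

Definition log_contraction F (p : {ffun F -> R})
    (pr : diagonal_map R -> affine1 R) : R :=
  \sum_(S : F) p S * ln (ratio (pr (val S))).

Definition D_BA F (p : {ffun F -> R}) : R :=
  let l1 := log_contraction p fst in
  let l2 := log_contraction p snd in
  if 0 <= \sum_(S : F) p S * ln (ratio (val S).2 / ratio (val S).1) then
    entropy_sum p / l1 + marginal_entropy_sum p snd / l2
      - marginal_entropy_sum p snd / l1
  else
    entropy_sum p / l2 + marginal_entropy_sum p fst / l1
      - marginal_entropy_sum p fst / l2.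

(* The greatest element of A, and 0 if there is none. *)
Definition maximum (A : set R) : R := xget 0 (A `&` ubound A).

Lemma maximumE (A : set R) (m : R) : A m -> ubound A m -> maximum A = m.
Proof.
move=> Am ubm; apply: xget_unique => // x [Ax ubx].
by apply/eqP; rewrite eq_le ubm//= ubx.
Qed.

Definition H_BA F : R := maximum [set D_BA p | p in probability_vectors F].

End ledrappier_young_functional.

Section hausdorff_dimension.
Context {R : realType}.
Implicit Types A U : set (R * R).

(* The library's norm on R * R is the sup norm. *)
Definition euclidean_dist (z w : R * R) : R :=
  Num.sqrt ((z.1 - w.1) ^+ 2 + (z.2 - w.2) ^+ 2).

Local Open Scope ereal_scope.

Definition diam U : \bar R :=
  ereal_sup [set (euclidean_dist zw.1 zw.2)%:E | zw in U `*` U].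

(* The empty set has weight 0 for every s, including s = 0, and its supremum
   above is -oo. *)
Definition weight (s : R) U : \bar R :=
  if U == set0 then 0 else poweR (diam U) s.

Definition hausdorff_premeasure (s delta : R) A : \bar R :=
  ereal_inf [set \sum_(i <oo) weight s (U i) | U in
    [set U : (set (R * R))^nat |
       A `<=` \bigcup_i U i /\ forall i, diam (U i) <= delta%:E]].

Definition hausdorff_measure (s : R) A : \bar R :=
  ereal_sup [set hausdorff_premeasure s delta A | delta in
    [set delta : R | (0 < delta)%R]].

Definition hausdorff_dim A : \bar R :=
  ereal_inf [set s%:E | s in
    [set s : R | (0 <= s)%R /\ hausdorff_measure s A = 0]].

End hausdorff_dimension.

(* Main.v *)
Require Import Defs.
From mathcomp Require Import all_boot all_order all_algebra.
From mathcomp Require Import finmap.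
From mathcomp Require Import all_classical all_reals all_analysis.
From mathcomp Require Import ring lra zify.
Import Order.TTheory GRing.Theory Num.Theory.
Import numFieldNormedType.Exports.
(* The ratios of fraction fields have shadowed [Defs.ratio]. *)
Import Defs.
Set Implicit Arguments.
Unset Strict Implicit.
Unset Printing Implicit Defensive.
Local Open Scope classical_set_scope.
Local Open Scope ring_scope.

(* Upper bound: dim_H L <= H_BA (G_n) for every n >= 1, without separation.
   Code points by words over G_n. For a word with n letters, let m be the
   largest length whose slow contraction still exceeds the fast contraction at
   n; the n letters and the slow coordinates of the next m - n ones determine an
   approximate square. With the empirical frequencies at n and m, the number of
   these squares is governed by D at the frequencies of n, up to the variation
   between n and m of (slow entropy)/(slow contraction). That quantity is
   bounded and m can serve as the next n, so the variation is small at some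
   scale among boundedly many, and the squares found there cover L.

   Lower bound: H_BA (G_n) <= dim_H L + o(1). Split G_n into polynomially many
   classes on which both contraction ratios, and up to a factor 2 the number of
   maps with a given slow coordinate, are constant; this costs O(log n) of
   entropy against contractions of order n. For maps of equal ratio the
   separation hypotheses become a lower bound, proportional to the ratio, on the
   distance of distinct translations, so that every k-th map, with k
   independent of n, gives a genuinely separated grid of rows and columns.
   Products of grids are grids; a product in which the classes appear
   with frequencies close to p has dimension at least close to D(p), because a
   set of small diameter contains few of the points coded by long words. *)

(** * Separated words and the dimension of grids *)

(** Regrouped, each branch of D is the entropy conditional on the slow coordinate over the fast
    contraction, plus the entropy of the slow marginal over the slow contraction; both bounds work
    with these two summands. No measure is put on the attractor. In the lower bound, the mass
    distribution principle is replaced by counting: among the points coded by words of one long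
    length, a set of size r contains at most a proportion of order r^D. This requires finite covers,
    hence compactness. In the upper bound the squares are never counted either. Each gets as weight
    the likelihood of its code under the frequencies read off from that code; for fixed count
    vectors these weights sum to at most 1, and there are only polynomially many count vectors. The
    gap between the exponent s and H absorbs the polynomial. *)

(* In all that follows [co b] is the fast coordinate, playing the role of p_1 in
   the first branch of D, and [co (~~ b)] the slow one; [b = false] gives the
   second branch. *)
Definition co (b : bool) (T : Type) (z : T * T) : T := if b then z.1 else z.2.

Arguments co b {T} z.

Lemma co_eval (R : realType) b (S : diagonal_map R) z :
  co b (diagonal_eval S z) = affine_eval (co b S) (co b z).
Proof. by case: b. Qed.

Lemma co_comp (R : realType) b (S T : diagonal_map R) :
  co b (diagonal_comp S T) = affine_comp (co b S) (co b T).
Proof. by case: b. Qed.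

Section words.
Context {R : realType} (A K : eqType) (t : A -> R) (r y0 : R).
Context (e : rel A) (h : A -> K).
Hypothesis r_unit : 0 <= r <= 1.
Hypothesis t_unit : forall a, 0 <= t a <= 1 - r.
Hypothesis t_sep : forall a a', e a a' -> h a != h a' -> r <= `|t a - t a'|.
Hypothesis t_key : forall a a', e a a' -> h a = h a' -> t a = t a'.

Definition word_point (w : seq A) : R := foldr (fun a y => r * y + t a) y0 w.

Lemma word_point_eq w w' : all2 e w w' -> map h w = map h w' ->
  word_point w = word_point w'.
Proof.
elim: w w' => [|a w IH] [|a' w'] //= /andP[ea ew] [ha hw].
by rewrite (t_key ea ha) (IH w').
Qed.

(** Each of the first n letters changes the point by at most 1 - r at its own scale, and (1 - r)(1 +
    r + ... + r^(n-1)) = 1 - r^n. *)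
Lemma word_point_close n w w' : all2 e w w' ->
  drop n (map h w) = drop n (map h w') ->
  `|word_point w - word_point w'| <= 1 - r ^+ n.
Proof.
have /andP[r0 r1] := r_unit.
elim: w n w' => [|a w IH] [|n] [|a' w'] //.
- by rewrite subrr normr0 expr0 subrr.
- by move=> _ _; rewrite subrr normr0 subr_ge0 exprn_ile1.
- move=> ew; rewrite !drop0 => hw.
  by rewrite (word_point_eq ew hw) subrr normr0 expr0 subrr.
move=> /= /andP[ea ew] hw; have := IH _ _ ew hw.
have := t_unit a; have := t_unit a'.
rewrite exprS -/(word_point w) -/(word_point w').
move: (word_point w) (word_point w') (r ^+ n) => y y' p.
rewrite !ler_norml => /andP[t1 t2] /andP[t3 t4] /andP[y1 y2].
have := ler_wpM2l r0 y1; have := ler_wpM2l r0 y2.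
rewrite mulrN !mulrBr mulr1 => q1 q2; apply/andP; split; lra.
Qed.

(** At the first letter with different keys the translations are r apart. If k letters before n
    remain, the tails undo at most r (1 - r^k) of this by [word_point_close], which leaves
    r^(k+1). *)
Lemma word_point_sep n w w' : all2 e w w' ->
  drop n (map h w) = drop n (map h w') -> map h w != map h w' ->
  r ^+ n <= `|word_point w - word_point w'|.
Proof.
have /andP[r0 r1] := r_unit.
elim: w n w' => [|a w IH] [|n] [|a' w'] //.
  by move=> _; rewrite !drop0 => ->; rewrite eqxx.
move=> /= /andP[ea ew] hw; have cl := word_point_close ew hw.
rewrite exprS eqseq_cons negb_and -/(word_point w) -/(word_point w').
have [ha /= hne|ha _] := eqVneq (h a) (h a').
  rewrite (t_key ea ha).
  rewrite (_ : _ - _ = r * (word_point w - word_point w')); last by ring.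
  by rewrite normrM (ger0_norm r0) ler_wpM2l// IH.
have := t_sep ea ha; move: cl.
move: (word_point w) (word_point w') (r ^+ n) => y y' p cl ts.
have cl' : `|r * (y - y')| <= r - r * p.
  by have := ler_wpM2l r0 cl; rewrite normrM ger0_norm//; lra.
rewrite (_ : r * y + t a - (r * y' + t a') = (t a - t a') + r * (y - y')); last by ring.
have := lerB_normD (t a - t a') (r * (y - y')); lra.
Qed.

End words.

(** Allows a set of size d to be enlarged to a positive size below 1 at arbitrarily small cost; d =
    0, the case of a one-point set, is included. *)
Lemma powR_right_approx (R : realType) (d D k : R) : 0 <= d < 1 -> 0 < D ->
  0 < k -> exists2 r, d < r < 1 & r `^ D <= d `^ D + k.
Proof.
move=> /andP[d0 d1] D0 k0; have Dn0 : D != 0 by rewrite gt_eqF.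
have DV x : 0 <= x -> (x `^ D^-1) `^ D = x.
  by move=> x0; rewrite -powRrM mulVf// powRr1.
have k1 : 0 <= d `^ D + k by rewrite addr_ge0// ?powR_ge0// ltW.
exists (Num.min ((1 + d) / 2) ((d `^ D + k) `^ D^-1)).
  rewrite lt_min gt_min -andbA; apply/and3P; split; [lra| |apply/orP; left; lra].
  have Vd : d = (d `^ D) `^ D^-1 by rewrite -powRrM divff// powRr1.
  rewrite [X in X < _]Vd gt0_ltr_powR//.
  - by rewrite invr_gt0.
  - by rewrite nnegrE powR_ge0.
  - by rewrite ltrDl.
rewrite -[leRHS](DV _ k1); apply: ge0_ler_powR; first exact: ltW.
- by rewrite nnegrE le_min powR_ge0 andbT; lra.
- by rewrite nnegrE powR_ge0.
- by rewrite ge_min lexx orbT.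
Qed.

(* Row i, column j: the maps of a row share their slow coordinate, rows are
   separated in the slow coordinate and the maps of one row in the fast one. *)
Record is_grid (R : realType) (L : set (R * R)) (b : bool) (I J : finType)
    (s : I -> J -> diagonal_map R) (a c : R) : Prop := IsGrid {
  grid_stable : forall i j z, L z -> L (diagonal_eval (s i j) z);
  grid_unit : forall i j b',
    0 <= (co b' (s i j)).2 <= 1 - ratio (co b' (s i j));
  grid_fast : forall i j, ratio (co b (s i j)) = expR (- a);
  grid_slow : forall i j, ratio (co (~~ b) (s i j)) = expR (- c);
  grid_row : forall i j j',
    (co (~~ b) (s i j)).2 = (co (~~ b) (s i j')).2;
  grid_rows_sep : forall i i' j j', i != i' ->
    expR (- c) <= `|(co (~~ b) (s i j)).2 - (co (~~ b) (s i' j')).2|;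
  grid_cols_sep : forall i j j', j != j' ->
    expR (- a) <= `|(co b (s i j)).2 - (co b (s i j')).2| }.

Definition grid_point (R : realType) (I J : finType)
    (s : I -> J -> diagonal_map R) (z0 : R * R) (w : seq (I * J)) : R * R :=
  foldr (fun p z => diagonal_eval (s p.1 p.2) z) z0 w.

(** * Counting the coded points of a grid in small sets *)

Section grid_dimension.
Context {R : realType} (L : set (R * R)) (b : bool) (I J : finType).
Context (s : I -> J -> diagonal_map R) (a c : R).
Hypothesis s_grid : is_grid L b s a c.
Hypothesis a_ge0 : 0 <= a.
Hypothesis c_ge0 : 0 <= c.
Context (z0 : R * R).
Hypothesis Lz0 : L z0.

Local Notation point := (grid_point s z0).

Lemma grid_pointP w : L (point w).
Proof. by elim: w => //= p w IH; apply: (grid_stable s_grid). Qed.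

Let expRN_unit (x : R) : 0 <= x -> 0 <= expR (- x) <= 1.
Proof. by move=> x0; rewrite expR_ge0 -expR0 ler_expR oppr_le0. Qed.

Let point_slow w : co (~~ b) (point w) =
  word_point (fun p => (co (~~ b) (s p.1 p.2)).2) (expR (- c)) (co (~~ b) z0) w.
Proof.
elim: w => //= p w IH; rewrite co_eval /affine_eval IH.
by congr (_ * _ + _); exact: (grid_slow s_grid).
Qed.

Let point_fast w : co b (point w) =
  word_point (fun p => (co b (s p.1 p.2)).2) (expR (- a)) (co b z0) w.
Proof.
elim: w => //= p w IH; rewrite co_eval /affine_eval IH.
by congr (_ * _ + _); exact: (grid_fast s_grid).
Qed.

Let point_rows n (w w' : seq (I * J)) : size w = size w' ->
  drop n (unzip1 w) = drop n (unzip1 w') -> unzip1 w != unzip1 w' ->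
  expR (- c) ^+ n <= `|co (~~ b) (point w) - co (~~ b) (point w')|.
Proof.
move=> sw dw nw; rewrite !point_slow.
apply: (@word_point_sep _ _ _ _ _ _ (fun _ _ => true) fst) => //.
- exact: expRN_unit.
- by move=> [i j]; have := grid_unit s_grid i j (~~ b); rewrite (grid_slow s_grid).
- by move=> [i j] [i' j'] _ /= ii'; apply: (grid_rows_sep s_grid).
- by move=> [i j] [i' j'] _ /= ->; apply: (grid_row s_grid).
- by elim: w w' sw {dw nw} => [|x w IH] [|x' w'] //= [] /IH ->.
Qed.

Let point_cols n (w w' : seq (I * J)) : unzip1 w = unzip1 w' ->
  drop n w = drop n w' -> w != w' ->
  expR (- a) ^+ n <= `|co b (point w) - co b (point w')|.
Proof.
move=> rw dw nw; rewrite !point_fast.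
apply: (@word_point_sep _ _ _ _ _ _ (fun p q => p.1 == q.1) id);
  rewrite ?map_id//.
- exact: expRN_unit.
- by move=> [i j]; have := grid_unit s_grid i j b; rewrite (grid_fast s_grid).
- move=> [i j] [i' j'] /eqP /= <-; rewrite xpair_eqE eqxx /= => jj'.
  exact: (grid_cols_sep s_grid).
- by move=> p q _ ->.
- by elim: w w' rw {dw nw} => [|x w IH] [|x' w'] //= [] -> /IH ->; rewrite eqxx.
Qed.

(* Two words whose points lie in V and which have the same row tail have the
   same rows by slow separation; then the same column tail forces equality. *)
Lemma grid_count n1 n2 K (rho : R) (V : set (R * R)) :
  (n1 <= K)%N -> (n2 <= K)%N ->
  (forall z z' b', V z -> V z' -> `|co b' z - co b' z'| <= rho) ->
  rho < expR (- a) ^+ n1 -> rho < expR (- c) ^+ n2 ->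
  (#|[pred w : K.-tuple (I * J) | `[< V (point w) >]]|
     <= #|I| ^ (K - n2) * #|J| ^ (K - n1))%N.
Proof.
move=> n1K n2K Vrho r1 r2.
have dropP T n (t : K.-tuple T) : size (drop n t) == (K - n)%N.
  by rewrite size_drop size_tuple.
pose f (w : K.-tuple (I * J)) : (K - n2).-tuple I * (K - n1).-tuple J :=
  (Tuple (dropP _ n2 [tuple of unzip1 w]), Tuple (dropP _ n1 [tuple of unzip2 w])).
have -> : (#|I| ^ (K - n2) * #|J| ^ (K - n1))%N =
    #|{: (K - n2).-tuple I * (K - n1).-tuple J}|.
  by rewrite card_prod !card_tuple.
apply: (@leq_card_in _ _ f).
move=> w w' Ww Ww' [] d1 d2.
have Vw : V (point w) by apply/asboolP.
have Vw' : V (point w') by apply/asboolP.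
have sw : size w = size w' by rewrite !size_tuple.
have rw : unzip1 w = unzip1 w'.
  apply/eqP; apply: contraT => /(point_rows sw d1).
  by move/(lt_le_trans r2); rewrite ltNge Vrho.
have dw : drop n1 w = drop n1 w'.
  rewrite -(zip_unzip (drop n1 w)) -(zip_unzip (drop n1 w')) /unzip1 /unzip2.
  by rewrite !map_drop -/(unzip1 _) -/(unzip2 _) rw d2.
apply: val_inj => /=; apply/eqP; apply: contraT => /(point_cols rw dw).
by move/(lt_le_trans r1); rewrite ltNge Vrho.
Qed.

End grid_dimension.

Lemma exp_scale (R : realType) (a r : R) : 0 < a -> 0 < r < 1 ->
  exists n : nat, r < expR (- a) ^+ n /\ - (a * n.+1%:R) <= ln r.
Proof.
move=> a0 /andP[r0 r1].
have expE n : expR (- a) ^+ n = expR (- (a * n%:R)).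
  by rewrite -expRM_natl mulrC mulNr.
have ex : exists n, expR (- a) ^+ n <= r.
  exists (Num.trunc (- ln r / a)).+1; rewrite expE -[leRHS]lnK ?posrE// ler_expR.
  rewrite lerNl mulrC -ler_pdivrMr//; apply: ltW; exact: truncnS_gt.
have [[|n] nr mn] := ex_minnP ex.
  by move: nr; rewrite expr0 leNgt r1.
exists n; split; first by rewrite ltNge; apply/negP => /mn; rewrite ltnn.
by rewrite -ler_expR lnK ?posrE// -expE.
Qed.

Section grid_dimension2.
Context {R : realType} (L : set (R * R)) (b : bool) (I J : finType).
Context (s : I -> J -> diagonal_map R) (a c : R).
Hypothesis s_grid : is_grid L b s a c.
Hypothesis a_gt0 : 0 < a.
Hypothesis c_gt0 : 0 < c.
Context (z0 : R * R).
Hypothesis Lz0 : L z0.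
Hypothesis I_gt0 : (0 < #|I|)%N.
Hypothesis J_gt0 : (0 < #|J|)%N.

Let x : R := ln #|J|%:R.
Let y : R := ln #|I|%:R.
Let D := x / a + y / c.

(** The sets cover all points coded by K-letter words, and each [V i] contains a proportion of at
    most [expR (x + y)] times the D-th power of [r i]. The factor [expR (x + y)] pays for [n.+1] in
    place of n in [exp_scale]. *)
Lemma grid_cover_ge1 N (V : nat -> set (R * R)) (r : nat -> R) :
  L `<=` \bigcup_(i < N) V i ->
  (forall i, 0 < r i < 1) ->
  (forall i z z' b', V i z -> V i z' -> `|co b' z - co b' z'| <= r i) ->
  1 <= \sum_(i < N) expR (x + y) * r i `^ D.
Proof.
move=> LV r01 Vr.
have [n1 n1P] := choice (fun i => exp_scale a_gt0 (r01 i)).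
have [n2 n2P] := choice (fun i => exp_scale c_gt0 (r01 i)).
(* One word length for all the sets; any common bound of the scales would do. *)
pose K := (\sum_(i < N) (n1 i + n2 i))%N.
have leK (i : 'I_N) : (n1 i <= K)%N /\ (n2 i <= K)%N.
  have : (n1 i + n2 i <= K)%N by rewrite /K (bigD1 i)//= leq_addr.
  by move=> le_K; split; apply: leq_trans le_K; rewrite ?leq_addr ?leq_addl.
pose W i := [pred w : K.-tuple (I * J) | `[< V i (grid_point s z0 w) >]].
have cardW : ((#|I| * #|J|) ^ K <= \sum_(i < N) #|W i|)%N.
  rewrite -card_prod -card_tuple -sum1_card.
  under [X in (_ <= X)%N]eq_bigr do rewrite -sum1_card.
  under [X in (_ <= X)%N]eq_bigr do rewrite big_mkcond.
  rewrite exchange_big; apply: leq_sum => w _ /=.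
  have [i iN Vi] := LV _ (grid_pointP s_grid Lz0 w).
  by rewrite (bigD1 (Ordinal iN))//= ifT//; exact: asboolT Vi.
have cardWi (i : 'I_N) :
    (#|W i|)%:R <= ((#|I| * #|J|) ^ K)%:R * (expR (x + y) * r i `^ D) :> R.
  have [le1 le2] := leK i; have [r1 l1] := n1P i; have [r2 l2] := n2P i.
  have r0 : 0 < r i by case/andP: (r01 i).
  have := grid_count s_grid (ltW a_gt0) (ltW c_gt0) z0 le1 le2 (Vr i) r1 r2.
  rewrite -(ler_nat R) => cnt; apply: (le_trans cnt).
  have expX (n : nat) u : (0 < n)%N -> (n ^ u)%:R = expR (u%:R * ln n%:R) :> R.
    by move=> n0; rewrite natrX expRM_natl lnK// posrE ltr0n.
  rewrite expnMn !natrM !expX// -/x -/y /powR gt_eqF// -!expRD ler_expR.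
  rewrite !natrB// /D.
  have x0 : 0 <= x / a by rewrite divr_ge0// ?ln_ge0// ?ler1n// ltW.
  have y0 : 0 <= y / c by rewrite divr_ge0// ?ln_ge0// ?ler1n// ltW.
  have := ler_wpM2l x0 l1; have := ler_wpM2l y0 l2.
  rewrite !mulrN !mulrA !mulfVK ?gt_eqF//.
  rewrite -(addn1 (n1 i)) -(addn1 (n2 i)) !natrD; lra.
have P0 : 0 < ((#|I| * #|J|) ^ K)%:R :> R.
  by rewrite ltr0n expn_gt0 muln_gt0 I_gt0 J_gt0.
rewrite -(ler_pM2l P0) mulr1 mulr_sumr.
apply: (@le_trans _ _ (\sum_(i < N) (#|W i|)%:R)).
  by rewrite -natr_sum ler_nat.
by apply: ler_sum => i _; exact: cardWi.
Qed.

End grid_dimension2.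

Lemma co_dist_le (R : realType) b (z w : R * R) :
  `|co b z - co b w| <= euclidean_dist z w.
Proof.
rewrite -sqrtr_sqr /euclidean_dist ler_sqrt ?addr_ge0 ?sqr_ge0//.
by case: b => /=; rewrite ?lerDl ?lerDr sqr_ge0.
Qed.

Lemma diam_ge (R : realType) (U : set (R * R)) z w : U z -> U w ->
  ((euclidean_dist z w)%:E <= diam U)%E.
Proof. by move=> Uz Uw; apply: ereal_sup_ubound; exists (z, w). Qed.

Lemma diam_ge0 (R : realType) (U : set (R * R)) z : U z -> (0 <= diam U)%E.
Proof.
by move=> Uz; apply: le_trans (diam_ge Uz Uz); rewrite lee_fin sqrtr_ge0.
Qed.

Lemma weight_ge0 (R : realType) (s : R) (U : set (R * R)) :
  (0 <= weight s U)%E.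
Proof. by rewrite /weight; case: ifP => // _; exact: poweR_ge0. Qed.

(** Compactness needs open sets, so the sides may grow from d to any larger r. *)
Lemma open_thickening (R : realType) (U : set (R * R)) (d r : R) :
  (forall z w b, U z -> U w -> `|co b z - co b w| <= d) -> d < r ->
  exists V : set (R * R), [/\ open V, U `<=` V &
    forall z w b, V z -> V w -> `|co b z - co b w| <= r].
Proof.
move=> Ud dr; pose e := (r - d) / 2; have e0 : 0 < e by rewrite /e; lra.
exists (\bigcup_(u in U) ball u e); split.
- by apply: bigcup_open => u _; exact: ball_open.
- by move=> u Uu; exists u => //; exact: ballxx.
have ball_co (u z : R * R) b : ball u e z -> `|co b u - co b z| < e.
  by case: b => -[].
move=> z w b [u Uu /(ball_co _ _ b) uz] [v Uv /(ball_co _ _ b) vw].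
have := Ud _ _ b Uu Uv; move: uz vw; rewrite /e.
move: (co b u) (co b z) (co b v) (co b w) => p1 p2 p3 p4.
rewrite !ltr_norml !ler_norml => /andP[h1 h2] /andP[h3 h4] /andP[h5 h6].
apply/andP; split; lra.
Qed.

Lemma sum_half_lt1 (R : realType) N : \sum_(i < N) (2^-1 : R) ^+ i.+1 < 1.
Proof.
suff -> : \sum_(i < N) (2^-1 : R) ^+ i.+1 = 1 - 2^-1 ^+ N.
  by rewrite ltrBlDr ltrDl exprn_gt0// invr_gt0.
elim: N => [|N IH]; first by rewrite big_ord0 expr0 subrr.
by rewrite big_ord_recr /= IH exprS; field.
Qed.

(** If t < D, a cover of small weight at exponent t is also small at exponent D. Thickened to open
    sets and reduced to finitely many by compactness, it contradicts [grid_cover_ge1]. *)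
Lemma grid_dimension (R : realType) (L : set (R * R)) b (I J : finType)
    (s : I -> J -> diagonal_map R) (a c t : R) :
  compact L -> L !=set0 -> is_grid L b s a c -> 0 < a -> 0 < c ->
  (0 < #|I|)%N -> (0 < #|J|)%N ->
  0 <= t -> hausdorff_measure t L = 0%E ->
  ln #|J|%:R / a + ln #|I|%:R / c <= t.
Proof.
move=> cL [z0 Lz0] sg a0 c0 I0 J0 t0 Ht.
rewrite leNgt; apply/negP => tD.
set x := ln _ in tD; set y := ln _ in tD; set D := x / a + y / c in tD.
have D0 : 0 < D by exact: le_lt_trans tD.
(* The cover contributes at most eta and the thickening less than eta, whereas [grid_cover_ge1] asks
   for a sum of at least [4 * eta]. *)
pose eta := expR (- (x + y)) / 4; have eta0 : 0 < eta by rewrite divr_gt0 ?expR_gt0.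
(* For diameters below 1 the weight at exponent t dominates the one at the larger exponent D. *)
have : (hausdorff_premeasure t 2^-1 L < eta%:E)%E.
  apply: (@le_lt_trans _ _ 0%E); last by rewrite lte_fin.
  by rewrite -Ht; apply: ereal_sup_ubound; exists 2^-1; rewrite //= invr_gt0.
move=> /ereal_inf_lt[_ [U [LU diamU] <-]] sumU.
have /choice[d dP] i : exists d : R, [/\ 0 <= d < 1,
    forall z w b, U i z -> U i w -> `|co b z - co b w| <= d &
    ((d `^ D)%:E <= weight t (U i))%E].
  have [->|/set0P[u Uu]] := eqVneq (U i) set0.
    exists 0; split => //; first by rewrite lexx ltr01.
    by rewrite powR0 ?gt_eqF// weight_ge0.
  have := diam_ge0 Uu; have := diamU i.
  have diamE := @diam_ge _ (U i).
  rewrite /weight ifF; last by apply/negbTE/set0P; exists u.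
  case: (diam (U i)) diamE => // d diamE; rewrite !lee_fin => d1 d0.
  exists d; split; first lra.
    by move=> z w b' Uz Uw; have := diamE _ _ Uz Uw; rewrite lee_fin; exact/le_trans/co_dist_le.
  rewrite /= lee_fin; have [->|dn0] := eqVneq d 0.
    by rewrite powR0 ?gt_eqF// powR_ge0.
  rewrite /powR (negbTE dn0) ler_expR; apply: ler_wnM2r; last exact: ltW.
  by apply: ln_le0; lra.
have /choice[r rP] i : exists r, d i < r < 1 /\
    r `^ D <= d i `^ D + eta * 2^-1 ^+ i.+1.
  have [dU _ _] := dP i.
  have [|r] := powR_right_approx dU D0 (k := eta * 2^-1 ^+ i.+1).
    by rewrite mulr_gt0 ?exprn_gt0 ?invr_gt0.
  by exists r.
have r01 i : 0 < r i < 1.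
  have [/andP[d0 _] _ _] := dP i; have [/andP[r0 r1] _] := rP i.
  by rewrite r1 (le_lt_trans d0).
have /choice[V VP] i : exists V : set (R * R), [/\ open V, U i `<=` V &
    forall z w b, V z -> V w -> `|co b z - co b w| <= r i].
  by apply: (@open_thickening _ _ (d i)); [case: (dP i)|case: (rP i) => /andP[]].
have [N LN] : exists N, L `<=` \bigcup_(i < N) V i.
  have /(_ nat \oo (fun N z => (\bigcup_(i < N) V i) z) _) := (compact_near_coveringP L).1 cL.
  case=> [z /LU[i _ Ui]|N _ /(_ N (leqnn N)) LN]; last by exists N.
  have [oV UV _] := VP i.
  exists (V i, [set n | (i < n)%N]); first split => /=.
  - by apply: open_nbhs_nbhs; split => //; exact: UV.
  - by exists i.+1.
  - by move=> [w n] [/= Vw ni]; exists i.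
have := grid_cover_ge1 sg a0 c0 Lz0 I0 J0 LN r01.
have VP' i z z' b' : V i z -> V i z' -> `|co b' z - co b' z'| <= r i.
  by case: (VP i) => _ _; exact.
move=> /(_ VP'); rewrite -mulr_sumr -/x -/y -/D leNgt => /negP; apply.
have -> : 1 = expR (x + y) * (4 * eta) :> R.
  by rewrite /eta expRN; field; rewrite gt_eqF// expR_gt0.
rewrite ltr_pM2l ?expR_gt0//.
have sumd : \sum_(i < N) d i `^ D <= eta.
  rewrite -lee_fin -sumEFin; apply: le_trans (ltW sumU).
  apply: (@le_trans _ _ (\sum_(0 <= i < N) weight t (U i))%E).
    by rewrite big_mkord; apply: lee_sum => i _; case: (dP i).
  by apply: nneseries_lim_ge => i _ _; exact: weight_ge0.
apply: (@le_lt_trans _ _ (eta + eta * \sum_(i < N) 2^-1 ^+ i.+1)).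
  rewrite mulr_sumr; apply: (@le_trans _ _
    (\sum_(i < N) (d i `^ D + eta * 2^-1 ^+ i.+1))).
    by apply: ler_sum => i _; case: (rP i).
  by rewrite big_split/= lerD2r.
have := sum_half_lt1 R N; rewrite -(ltr_pM2l eta0); lra.
Qed.

(** Logarithmic data, so that composing grids adds them: x for the columns of each row, y for the
    rows, a and c for the fast and slow contractions. *)
Definition has_grid (R : realType) (L : set (R * R)) (b : bool)
    (x y a c : R) : Prop :=
  exists (I J : finType) (s : I -> J -> diagonal_map R),
    [/\ is_grid L b s a c, (0 < #|I|)%N, (0 < #|J|)%N,
        x = ln #|J|%:R & y = ln #|I|%:R].

(** The inner translations differ by at most 1 - r2, so the inner maps undo at most r1 (1 - r2) of
    an outer gap r1. *)
Lemma affine_trans_sep (R : realType) (r1 r2 t1 t1' t2 t2' : R) :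
  0 <= r1 -> 0 <= r2 -> 0 <= t2 <= 1 - r2 -> 0 <= t2' <= 1 - r2 ->
  r1 <= `|t1 - t1'| -> r1 * r2 <= `|r1 * t2 + t1 - (r1 * t2' + t1')|.
Proof.
move=> r10 r20 /andP[h1 h2] /andP[h3 h4] h.
have d2 : `|r1 * (t2' - t2)| <= r1 - r1 * r2.
  have : `|t2' - t2| <= 1 - r2 by rewrite ler_norml; apply/andP; split; lra.
  by move/(ler_wpM2l r10); rewrite normrM ger0_norm//; lra.
have -> : r1 * t2 + t1 - (r1 * t2' + t1') = t1 - t1' - r1 * (t2' - t2) by ring.
have := lerB_dist (t1 - t1') (r1 * (t2' - t2)); lra.
Qed.

(** * Products and mixtures of grids *)

Section grid_algebra.
Context {R : realType} (L : set (R * R)) (b : bool).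

Lemma has_grid0 : has_grid L b 0 0 0 0.
Proof.
exists unit, unit, (fun _ _ => diagonal_id); split; rewrite ?card_unit ?ln1//.
split => //.
- by move=> _ _ [u v]; rewrite /diagonal_eval /affine_eval /= !mul1r !addr0.
- by move=> _ _ b'; case: b'; rewrite /= /ratio /= subrr lexx.
- by move=> _ _; rewrite oppr0 expR0; case: (b).
- by move=> _ _; rewrite oppr0 expR0; case: (b).
Qed.

(** Rows and columns of the product are pairs. Pairs with different outer parts stay apart by
    [affine_trans_sep]; if the outer parts agree, the outer map only scales the inner gap. *)
Lemma has_gridD x y a c x' y' a' c' : has_grid L b x y a c ->
  has_grid L b x' y' a' c' -> has_grid L b (x + x') (y + y') (a + a') (c + c').
Proof.
move=> [I [J [s [sg I0 J0 -> ->]]]] [I' [J' [s' [sg' I0' J0' -> ->]]]].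
exists (I * I')%type, (J * J')%type,
  (fun i j => diagonal_comp (s i.1 j.1) (s' i.2 j.2)).
have fast i j := grid_fast sg i j; have fast' i j := grid_fast sg' i j.
have slow i j := grid_slow sg i j; have slow' i j := grid_slow sg' i j.
split; rewrite ?card_prod ?muln_gt0 ?I0 ?J0//; last 2 first.
- by rewrite natrM lnM// posrE ltr0n.
- by rewrite natrM lnM// posrE ltr0n.
split.
- move=> i j z Lz; rewrite diagonal_compE.
  by apply: (grid_stable sg); apply: (grid_stable sg').
- move=> i j b'; rewrite co_comp /affine_comp /ratio /=.
  have r0 : 0 <= (co b' (s i.1 j.1)).1.
    have [->|/negPf bb'] := eqVneq b' b; first by rewrite [X in _ <= X]fast expR_ge0.
    have -> : b' = ~~ b by case: (b') (b) bb' => -[].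
    by rewrite [X in _ <= X]slow expR_ge0.
  have := grid_unit sg i.1 j.1 b'; have := grid_unit sg' i.2 j.2 b'.
  rewrite /ratio => /andP[h1 h2] /andP[h3 h4].
  have := ler_wpM2l r0 h1; have := ler_wpM2l r0 h2; rewrite mulr0 mulrBr mulr1.
  by move=> h5 h6; apply/andP; split; lra.
- by move=> i j; rewrite co_comp opprD expRD -(fast i.1 j.1) -(fast' i.2 j.2).
- by move=> i j; rewrite co_comp opprD expRD -(slow i.1 j.1) -(slow' i.2 j.2).
- move=> i j j'; rewrite !co_comp /= (grid_row sg _ j.1 j'.1).
  rewrite (grid_row sg' _ j.2 j'.2); congr (_ * _ + _).
  by rewrite [LHS]slow [RHS]slow.
- move=> [i1 i2] [i1' i2'] j j' ii'; rewrite !co_comp /=.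
  rewrite -!/(ratio _) !slow opprD expRD.
  have [e1|n1] := eqVneq i1 i1'.
    subst i1'; rewrite (grid_row sg i1 j.1 j'.1) opprD addrACA subrr addr0 -mulrBr normrM.
    rewrite ger0_norm ?expR_ge0// ler_wpM2l ?expR_ge0//.
    apply: (grid_rows_sep sg'); apply: contra ii' => /eqP ->.
    by rewrite eqxx.
  apply: affine_trans_sep; rewrite ?expR_ge0//; last exact: (grid_rows_sep sg).
  + by rewrite -(slow' i2 j.2); exact: (grid_unit sg').
  + by rewrite -(slow' i2' j'.2); exact: (grid_unit sg').
- move=> i [j1 j2] [j1' j2'] jj'; rewrite !co_comp /=.
  rewrite -!/(ratio _) !fast opprD expRD.
  have [e1|n1] := eqVneq j1 j1'.
    subst j1'; rewrite opprD addrACA subrr addr0 -mulrBr normrM.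
    rewrite ger0_norm ?expR_ge0// ler_wpM2l ?expR_ge0//.
    apply: (grid_cols_sep sg'); apply: contra jj' => /eqP ->.
    by rewrite eqxx.
  apply: affine_trans_sep; rewrite ?expR_ge0//; last exact: (grid_cols_sep sg).
  + by rewrite -(fast' i.2 j2); exact: (grid_unit sg').
  + by rewrite -(fast' i.2 j2'); exact: (grid_unit sg').
Qed.

Lemma has_grid_sum (T : finType) (k : T -> nat) (x y a c : T -> R) :
  (forall i, has_grid L b (x i) (y i) (a i) (c i)) ->
  has_grid L b (\sum_i (k i)%:R * x i) (\sum_i (k i)%:R * y i)
    (\sum_i (k i)%:R * a i) (\sum_i (k i)%:R * c i).
Proof.
move=> g; elim: (index_enum T) => [|i r IH].
  by rewrite !big_nil; exact: has_grid0.
rewrite !big_cons.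
apply: has_gridD => //; elim: (k i) => [|n IHn].
  by rewrite !mul0r; exact: has_grid0.
by rewrite -addn1 natrD !mulrDl !mul1r; exact: has_gridD.
Qed.

Lemma has_grid_dimension x y a c t : compact L -> L !=set0 ->
  has_grid L b x y a c -> 0 < a -> 0 < c -> 0 <= t ->
  hausdorff_measure t L = 0%E -> x / a + y / c <= t.
Proof.
by move=> cL L0 [I [J [s [sg I0 J0 -> ->]]]] a0 c0; exact: grid_dimension sg _ _ _ _.
Qed.

(* Approximating the weights p i by the integers floor (m * p i) and letting m
   tend to infinity. *)
Lemma has_grid_mixture (T : finType) (p x y a c : T -> R) (t : R) :
  compact L -> L !=set0 -> 0 <= t -> hausdorff_measure t L = 0%E ->
  (forall i, 0 <= p i) -> \sum_i p i = 1 ->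
  (forall i, 0 < a i) -> (forall i, 0 < c i) ->
  (forall i, 0 <= x i) -> (forall i, 0 <= y i) ->
  (forall i, has_grid L b (x i) (y i) (a i) (c i)) ->
  (\sum_i p i * x i) / (\sum_i p i * a i) +
    (\sum_i p i * y i) / (\sum_i p i * c i) <= t.
Proof.
move=> cL L0 t0 Ht p0 p1 a0 c0 x0 y0 g.
have mean_gt0 (u : T -> R) : (forall i, 0 < u i) -> 0 < \sum_i p i * u i.
  move=> u0; have u_ge0 i : 0 <= p i * u i by rewrite mulr_ge0// ltW.
  rewrite lt_neqAle sumr_ge0// andbT eq_sym psumr_eq0//; apply/negP => /allP E.
  move: p1; rewrite big1 => [/eqP|i _]; first by rewrite eq_sym oner_eq0.
  have := E i (mem_index_enum i); rewrite mulf_eq0 (gt_eqF (u0 i)) orbF.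
  by move/eqP.
have A0 := mean_gt0 _ a0; have C0 := mean_gt0 _ c0.
set A := \sum_i _ in A0 *; set C := \sum_i p i * c i in C0 *.
set X := \sum_i p i * x i; set Y := \sum_i p i * y i.
pose X0 := \sum_i x i; pose Y0 := \sum_i y i.
have bound (m : nat) : (0 < m)%N -> X / A + Y / C - (X0 / A + Y0 / C) / m%:R <= t.
  move=> m0; pose k i := Num.trunc (m%:R * p i).
  have mR0 : 0 < m%:R :> R by rewrite ltr0n.
  have k_le i : (k i)%:R <= m%:R * p i by rewrite truncn_le// mulr_ge0// ler0n.
  have k_gt i : m%:R * p i - 1 <= (k i)%:R.
    by rewrite lerBlDr -[1]/(1%:R) -natrD addn1 ltW// truncnS_gt.
  have sum_le (u : T -> R) : (forall i, 0 <= u i) ->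
      \sum_i (k i)%:R * u i <= m%:R * \sum_i p i * u i.
    move=> u0; rewrite mulr_sumr; apply: ler_sum => i _.
    by rewrite mulrA ler_wpM2r.
  have sum_ge (u : T -> R) : (forall i, 0 <= u i) ->
      m%:R * \sum_i p i * u i - \sum_i u i <= \sum_i (k i)%:R * u i.
    move=> u0; rewrite mulr_sumr -sumrB; apply: ler_sum => i _.
    have := ler_wpM2r (u0 i) (k_gt i); rewrite mulrBl mul1r; lra.
  have gk := has_grid_sum k g.
  (* Rounding down only shrinks the denominator and costs the numerator at most U0. *)
  have frac (u v U V U0 : R) : 0 < V -> 0 < v -> 0 <= u -> v <= m%:R * V ->
      m%:R * U - U0 <= u -> U / V - U0 / V / m%:R <= u / v.
    move=> V0 v0 u0 vV Uu; rewrite ler_pdivlMr//.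
    have -> : U / V - U0 / V / m%:R = (m%:R * U - U0) / (m%:R * V).
      by field; rewrite !gt_eqF.
    rewrite mulrAC ler_pdivrMr ?mulr_gt0//.
    have [UU0|UU0] := leP 0 (m%:R * U - U0).
      by apply: ler_pM => //; exact: ltW.
    apply: (@le_trans _ _ 0); first by rewrite mulr_le0_ge0// ltW.
    by rewrite mulr_ge0// mulr_ge0// ltW.
  have sum0 (u : T -> R) : (forall i, 0 <= u i) -> 0 <= \sum_i (k i)%:R * u i.
    by move=> u0; apply: sumr_ge0 => i _; rewrite mulr_ge0.
  (* If every k i is 0, the product grid does not contract and [has_grid_dimension] does not apply,
     but then both numerators on the left are nonpositive. *)
  have [/forallP k0|/forallPn[j kj]] := boolP [forall i, k i == 0%N].
    have U0 u : (forall i, 0 <= u i) -> m%:R * \sum_i p i * u i - \sum_i u i <= 0.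
      by move=> /sum_ge /le_trans; apply; rewrite big1// => i _; rewrite (eqP (k0 i)) mul0r.
    apply: le_trans t0.
    have -> : X / A + Y / C - (X0 / A + Y0 / C) / m%:R =
        (m%:R * X - X0) / (m%:R * A) + (m%:R * Y - Y0) / (m%:R * C).
      by field; rewrite !gt_eqF.
    by rewrite -[leRHS](addr0 0) lerD// mulr_le0_ge0 ?U0// invr_ge0 mulr_ge0// ltW.
  have pos (u : T -> R) : (forall i, 0 < u i) -> 0 < \sum_i (k i)%:R * u i.
    move=> u0; rewrite (bigD1 j)//= ltr_wpDr//.
      by apply: sumr_ge0 => i _; rewrite mulr_ge0// ltW.
    by rewrite mulr_gt0// ltr0n lt0n.
  have := has_grid_dimension cL L0 gk (pos _ a0) (pos _ c0) t0 Ht.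
  apply: le_trans.
  have -> : X / A + Y / C - (X0 / A + Y0 / C) / m%:R =
    (X / A - X0 / A / m%:R) + (Y / C - Y0 / C / m%:R) by ring.
  have ge0 (u : T -> R) : (forall i, 0 < u i) -> forall i, 0 <= u i.
    by move=> u0 i; exact: ltW.
  by apply: lerD; apply: frac; rewrite ?pos ?sum0 ?sum_ge ?sum_le//; exact: ge0.
set E := X0 / A + Y0 / C in bound.
have E0 : 0 <= E.
  by apply: addr_ge0; apply: divr_ge0; (exact: ltW || exact: sumr_ge0).
rewrite -/A -/C; apply/ler_addgt0Pr => e e0.
have [m m0] : exists m : nat, (0 < m)%N /\ E / m%:R <= e.
  exists (Num.trunc (E / e)).+1; split => //.
  rewrite ler_pdivrMr ?ltr0n// mulrC -ler_pdivrMr//; apply: ltW; exact: truncnS_gt.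
have := bound m m0.1; have := m0.2; lra.
Qed.

End grid_algebra.

(** * Entropy of finite distributions *)

(** Sort and take every k-th element: consecutive gaps of at least e add up to k e. The last
    condition says that the largest index used, (N - 1) k, is in range. *)
Lemma separated_subfamily (R : realType) (xs : seq R) (e d : R) (k N : nat) :
  uniq xs -> 0 <= e -> {in xs &, forall x y, x != y -> e <= `|x - y|} ->
  d <= k%:R * e -> (N * k < size xs + k)%N ->
  exists f : 'I_N -> R, (forall i, f i \in xs) /\
    forall i i', i != i' -> d <= `|f i - f i'|.
Proof.
move=> uxs e0 sep dk Nk.
pose s := sort <=%R xs.
have ss : sorted <=%R s by apply: sort_sorted; exact: le_total.
have us : uniq s by rewrite sort_uniq.
have szs : size s = size xs by rewrite size_sort.
have mem_s x : (x \in s) = (x \in xs) by rewrite mem_sort.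
have gap i m : (i + m < size xs)%N -> m%:R * e <= s`_(i + m) - s`_i.
  elim: m => [|m IH] im; first by rewrite addn0 subrr mul0r.
  have im' : (i + m < size xs)%N by apply: leq_trans im; rewrite addnS.
  have lei : s`_(i + m) <= s`_(i + m.+1).
    by apply: (sorted_leq_nth le_trans le_refl) => //;
      rewrite ?inE ?szs// addnS leqnSn.
  have := sep s`_(i + m.+1) s`_(i + m).
  rewrite -!mem_s !mem_nth ?szs// nth_uniq ?szs// => /(_ isT isT).
  rewrite ger0_norm ?subr_ge0// addnS gtn_eqF// => /(_ isT).
  by have := IH im'; rewrite -[m.+1]addn1 natrD; lra.
have ik (i : 'I_N) : (i * k < size xs)%N.
  have : (i.+1 * k <= N * k)%N by rewrite leq_mul2r ltn_ord orbT.
  by rewrite mulSn addnC => h; have := leq_ltn_trans h Nk; rewrite ltn_add2r.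
exists (fun i => s`_(i * k)); split.
  by move=> i; rewrite -mem_s mem_nth ?szs.
suff lt_case (i i' : 'I_N) : (i < i')%N -> d <= `|s`_(i * k) - s`_(i' * k)|.
  move=> i i'; rewrite neq_ltn => /orP[/lt_case//|/lt_case].
  by rewrite distrC.
move=> ii'; have := gap (i * k)%N ((i' - i) * k)%N.
rewrite -mulnDl subnKC ?(ltnW ii')// => /(_ (ik i')) g.
rewrite distrC; apply: le_trans (ler_norm _); apply: le_trans g.
apply: le_trans dk _; rewrite natrM ler_wpM2r// ler_peMl// ler1n subn_gt0//.
Qed.

Definition marg (R : realType) (I J : finType) (r : I -> J) (p : I -> R) (j : J) :=
  \sum_(i | r i == j) p i.

Section entropy_bounds.
Context {R : realType} (I J T : finType) (p : I -> R) (r : I -> J) (k : I -> T).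
Hypothesis p_ge0 : forall i, 0 <= p i.
Hypothesis p_sum : \sum_i p i = 1.

Local Notation q := (marg r p).

Lemma marg_sum : \sum_j q j = 1.
Proof. by rewrite -p_sum (partition_big r predT). Qed.

Lemma marg_ge i : p i <= q (r i).
Proof. by rewrite /marg (bigD1 i)//= lerDl sumr_ge0. Qed.

Lemma marg_ge0 j : 0 <= q j.
Proof. by rewrite /marg sumr_ge0. Qed.

(* Gibbs' inequality, from ln w <= w - 1. *)
Lemma mean_ln_le0 (w : I -> R) : (forall i, 0 < p i -> 0 < w i) ->
  \sum_i p i * w i <= 1 -> \sum_i p i * ln (w i) <= 0.
Proof.
move=> w0 w1; apply: (@le_trans _ _ (\sum_i (p i * w i - p i))).
  apply: ler_sum => i _; have := p_ge0 i; rewrite le_eqVlt => /orP[/eqP <-|pi].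
    by rewrite !mul0r subrr.
  rewrite -[X in _ - X]mulr1 -mulrBr ler_pM2l//.
  have := @le_ln1Dx R (w i - 1); rewrite (_ : 1 + (w i - 1) = w i); last by ring.
  apply.
  by rewrite ltrBrDr addNr w0.
by rewrite sumrB p_sum subr_le0.
Qed.

Definition fiber_card (i : I) := #|[pred i' | (r i' == r i) && (k i' == k i)]|.

Definition row_card (t : T) :=
  #|[pred j | [exists i, (r i == j) && (k i == t)]]|.

Lemma fiber_card_gt0 i : (0 < fiber_card i)%N.
Proof. by apply/card_gt0P; exists i; rewrite inE !eqxx. Qed.

Lemma row_card_gt0 i : (0 < row_card (k i))%N.
Proof.
by apply/card_gt0P; exists (r i); apply/existsP; exists i; rewrite !eqxx.
Qed.

Let T_gt0 : (0 < #|T|)%N.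
Proof.
apply/card_gt0P; suff [i _] : exists i : I, true by exists (k i).
apply/existsP; rewrite -[X in is_true X]negbK; apply/negP => /existsPn nI.
move: p_sum; rewrite big1 => [/eqP|i]; first by rewrite eq_sym oner_eq0.
by have := nI i.
Qed.

(** Once r is known, only a class and a member of the fibre remain to be chosen. [mean_ln_le0]
    compares p with drawing the r-value from q, the class uniformly and the letter uniformly in its
    fibre; this has total mass at most 1. *)
Lemma cond_entropy_le :
  - (\sum_i p i * ln (p i)) + \sum_i p i * ln (q (r i)) <=
  \sum_i p i * ln (fiber_card i)%:R + ln #|T|%:R.
Proof.
pose t : R := #|T|%:R; have t0 : 0 < t by rewrite ltr0n.
pose n i : R := (fiber_card i)%:R; have n0 i : 0 < n i by rewrite ltr0n fiber_card_gt0.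
pose w i := q (r i) / (p i * (t * n i)).
have : \sum_i p i * ln (w i) <= 0.
  apply: mean_ln_le0 => [i pi|].
    by rewrite divr_gt0 ?mulr_gt0// (lt_le_trans pi) ?marg_ge.
  rewrite -marg_sum [leRHS](eq_bigr (fun j => q j * 1)); last by move=> j _; rewrite mulr1.
  rewrite (partition_big r predT)//=; apply: ler_sum => j _.
  apply: (@le_trans _ _ (\sum_(i | r i == j) q j * (t * n i)^-1)).
    apply: ler_sum => i /eqP <-; have := p_ge0 i.
    rewrite le_eqVlt => /orP[/eqP pi|pi].
      by rewrite /w -pi mul0r mulr_ge0 ?marg_ge0// invr_ge0 mulr_ge0// ltW.
    have -> : p i * w i = q (r i) * (t * n i)^-1.
      by rewrite /w; field; rewrite -/(n i) -/t !gt_eqF.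
    exact: lexx.
  rewrite -mulr_sumr ler_wpM2l ?marg_ge0//.
  rewrite (partition_big k predT)//=.
  apply: (@le_trans _ _ (\sum_(u : T) t^-1)); last first.
    by rewrite sumr_const -mulr_natl mulfV// gt_eqF.
  apply: ler_sum => u _.
  have [i iju|nil] := pickP [pred i | (r i == j) && (k i == u)]; last first.
    by rewrite big_pred0 ?invr_ge0 ?ltW.
  move: iju; rewrite inE => /andP[/eqP ij /eqP iu].
  rewrite (eq_big [pred i' in [pred i' | (r i' == r i) && (k i' == k i)]]
    (fun=> (t * n i)^-1)); first last.
  - move=> i' /andP[/eqP ij' /eqP iu']; congr (_ * _)^-1; rewrite /n /fiber_card.
    by rewrite ij iu ij' iu'.
  - by move=> i'; rewrite !inE ij iu.
  by rewrite sumr_const -mulr_natl invfM mulrCA -[X in _ * X]/(n i / n i) mulfV ?gt_eqF// mulr1.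
have lnw i : p i * ln (w i) =
    p i * ln (q (r i)) - p i * ln (p i) - (p i * ln (n i) + p i * ln t).
  have := p_ge0 i; rewrite le_eqVlt => /orP[/eqP <-|pi]; first by rewrite !mul0r; lra.
  have qi := lt_le_trans pi (marg_ge i).
  rewrite /w ln_div ?posrE ?mulr_gt0// !lnM ?posrE ?mulr_gt0//; ring.
under eq_bigr do rewrite lnw.
rewrite !sumrB big_split/= -mulr_suml p_sum mul1r /t; lra.
Qed.

(** The comparison is now with a uniform class followed by a uniform row of that class. The mass of
    p in one row and one class is bounded by q of the row. *)
Lemma marg_entropy_le :
  - (\sum_i p i * ln (q (r i))) <=
  \sum_i p i * ln (row_card (k i))%:R + ln #|T|%:R.
Proof.
pose t : R := #|T|%:R; have t0 : 0 < t by rewrite ltr0n.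
pose m u : R := (row_card u)%:R; have m0 i : 0 < m (k i) by rewrite ltr0n row_card_gt0.
have tm0 u : 0 <= t * m u by apply: mulr_ge0; [exact: ltW|exact: ler0n].
pose w i := (q (r i) * (t * m (k i)))^-1.
have : \sum_i p i * ln (w i) <= 0.
  apply: mean_ln_le0 => [i pi|].
    by rewrite invr_gt0 !mulr_gt0// (lt_le_trans pi) ?marg_ge.
  rewrite (partition_big k predT)//=.
  apply: (@le_trans _ _ (\sum_(u : T) t^-1)); last first.
    by rewrite sumr_const -mulr_natl mulfV// gt_eqF.
  apply: ler_sum => u _; rewrite (partition_big r predT)//=.
  rewrite (bigID [pred j | [exists i, (r i == j) && (k i == u)]])/= addrC big1; last first.
    move=> j /existsPn nj; rewrite big_pred0// => i.
    by apply/negbTE; rewrite andbC; exact: nj.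
  rewrite add0r; apply: (@le_trans _ _
      (\sum_(j in [pred j | [exists i, (r i == j) && (k i == u)]]) (t * m u)^-1)).
    apply: ler_sum => j _.
    apply: (@le_trans _ _ (\sum_(i | r i == j) p i * (q j * (t * m u))^-1)).
      rewrite [leRHS](bigID [pred i | k i == u])/= ler_wpDr//.
        apply: sumr_ge0 => i _; by rewrite mulr_ge0// invr_ge0 mulr_ge0 ?marg_ge0.
      rewrite (eq_bigl (fun i => (r i == j) && (k i == u))); last by move=> i; rewrite andbC.
      by apply: ler_sum => i /andP[/eqP <- /eqP <-].
    rewrite -mulr_suml -/(q j) invfM mulrA.
    have : 0 <= (t * m u)^-1 by rewrite invr_ge0.
    have [->|qj] := eqVneq (q j) 0; first by rewrite invr0 mulr0 mul0r.
    by rewrite mulfV// mul1r.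
  rewrite sumr_const -mulr_natl invfM mulrCA.
  have : 0 <= m u by rewrite /m ler0n.
  rewrite -[#|_|%:R]/(m u) le_eqVlt => /orP[/eqP <-|mu].
    by rewrite mul0r mulr0 invr_ge0 ltW.
  by rewrite mulfV ?gt_eqF// mulr1.
have lnw i : p i * ln (w i) =
    - (p i * ln (q (r i)) + (p i * ln (m (k i)) + p i * ln t)).
  have := p_ge0 i; rewrite le_eqVlt => /orP[/eqP <-|pi]; first by rewrite !mul0r; lra.
  have qi := lt_le_trans pi (marg_ge i).
  rewrite /w lnV ?posrE ?mulr_gt0// !lnM ?posrE ?mulr_gt0//; ring.
under eq_bigr do rewrite lnw.
rewrite sumrN !big_split/= -mulr_suml p_sum mul1r /t; lra.
Qed.

End entropy_bounds.

(** * Carpets and separation of compositions *)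

Section carpet.
Context {R : realType} (G : {fset diagonal_map R}) (L : set (R * R)).
Hypothesis G_pos : orientation_preserving G.
Hypothesis G_carpet : self_affine_carpet G.
Hypothesis G_attractor : is_attractor G L.
Hypothesis L_normalized : normalized L.

Lemma n_foldP n S : reflect
  (exists s T, [/\ s \in G, T \in n_fold G n & S = diagonal_comp s T])
  (S \in n_fold G n.+1).
Proof.
apply: (iffP idP) => [/imfset2P[s /= sG [T TG ->]]|[s [T [sG TG ->]]]].
  by exists s, T.
by apply/imfset2P; exists s => //; exists T.
Qed.

Lemma ratio_G b s : s \in G -> 0 < ratio (co b s) < 1.
Proof.
move=> sG; have [p1 p2] := G_pos sG; have [] := G_carpet sG.
by rewrite !gtr0_norm//; case: b.
Qed.

Lemma convex_hull_attractor b : convex_hull (co b @` L) = `[0, 1]%classic.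
Proof.
have [[z0 Lz0] _ _] := G_attractor; have E := L_normalized.
have hullP A (u : R) : A u -> convex_hull A u by move=> Au; exact: sub_gen_smallest.
have h1 : convex_hull (fst @` L) z0.1 by apply: hullP; exists z0.
have h2 : convex_hull (snd @` L) z0.2 by apply: hullP; exists z0.
have [m1 m2] : `[0, 1]%classic z0.1 /\ `[0, 1]%classic z0.2.
  by have : (convex_hull (fst @` L) `*` convex_hull (snd @` L)) z0 by []; rewrite E.
case: b; apply/seteqP; split => u hu.
- have : (convex_hull (fst @` L) `*` convex_hull (snd @` L)) (u, z0.2) by [].
  by rewrite E => -[].
- by have : (`[0, 1] `*` `[0, 1]) (u, z0.2) by []; rewrite -E => -[].
- have : (convex_hull (fst @` L) `*` convex_hull (snd @` L)) (z0.1, u) by [].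
  by rewrite E => -[].
- by have : (`[0, 1] `*` `[0, 1]) (z0.1, u) by []; rewrite -E => -[].
Qed.

Lemma attractor_unit b z : L z -> 0 <= co b z <= 1.
Proof.
move=> Lz; have : convex_hull (co b @` L) (co b z).
  by apply: sub_gen_smallest; exists z.
by rewrite convex_hull_attractor /= in_itv.
Qed.

Lemma attractor_stable s z : s \in G -> L z -> L (diagonal_eval s z).
Proof.
by have [_ _ {2}->] := G_attractor => sG Lz; exists s => //; exists z.
Qed.

(** The reals that this coordinate of s maps into [0, 1] form a convex set containing the projection
    of L, hence all of [0, 1]; its two endpoints give the inequalities. *)
Lemma unit_G b s : s \in G -> 0 <= (co b s).2 <= 1 - ratio (co b s).
Proof.
move=> sG; pose A : set R := [set u | 0 <= affine_eval (co b s) u <= 1].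
have hullA : convex_hull (co b @` L) `<=` A.
  apply: smallest_sub => [u v l|_ [z Lz <-]].
    rewrite !inE /A /= => /andP[u0 u1] /andP[v0 v1].
    have -> : conv l u v = l%:num * (u : R) + (1 - l%:num) * (v : R) by exact: convRE.
    have l0 : 0 <= l%:num by [].
    have l1 : 0 <= 1 - l%:num by rewrite subr_ge0.
    rewrite (_ : affine_eval _ _ = l%:num * affine_eval (co b s) u +
      (1 - l%:num) * affine_eval (co b s) v); last by rewrite /affine_eval; ring.
    rewrite addr_ge0 ?mulr_ge0//=.
    have := ler_wpM2l l0 u1; have := ler_wpM2l l1 v1; lra.
  by rewrite /A /= -co_eval attractor_unit//; exact: attractor_stable.
rewrite convex_hull_attractor in hullA.
have /= := hullA 0; have /= := hullA 1.
rewrite /A /= !in_itv /= !lexx !ler01 /affine_eval mulr0 mulr1 add0r.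
by move=> /(_ isT)/andP[h1 h2] /(_ isT)/andP[h3 h4]; apply/andP; split; rewrite /ratio; lra.
Qed.

Lemma n_fold_facts n S : S \in n_fold G n -> [/\
  forall b, 0 < ratio (co b S), forall z, L z -> L (diagonal_eval S z) &
  forall b, 0 <= (co b S).2 <= 1 - ratio (co b S)].
Proof.
elim: n S => [|n IH] S.
  rewrite inE => /eqP ->; split=> [b|[u v] Lz|b].
  - by case: b => /=; rewrite ltr01.
  - by rewrite /diagonal_eval /affine_eval /= !mul1r !addr0.
  - by case: b; rewrite /= /ratio /= subrr lexx.
move=> /n_foldP[s [T [sG /IH[T1 T2 T3] ->]]]; split=> [b|z Lz|b].
- by rewrite co_comp; apply: mulr_gt0; [case/andP: (ratio_G b sG)|exact: T1].
- by rewrite diagonal_compE; apply: attractor_stable => //; exact: T2.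
- have /andP[r0 _] := ratio_G b sG; have := unit_G b sG; have := T3 b.
  rewrite co_comp /ratio /= in r0 * => /andP[h1 h2] /andP[h3 h4].
  have := ler_wpM2l (ltW r0) h1; have := ler_wpM2l (ltW r0) h2.
  by rewrite mulr0 mulrBr mulr1 => h5 h6; apply/andP; split; lra.
Qed.

Definition projected b : {fset affine1 R} :=
  if b then projected1 G else projected2 G.

Lemma n_fold_projected b n S : S \in n_fold G n ->
  co b S \in compositions affine_comp affine_id (projected b) n.
Proof.
elim: n S => [|n IH] S; first by rewrite !inE => /eqP ->; case: b.
move=> /n_foldP[s [T [sG TG ->]]]; rewrite co_comp.
apply/imfset2P; exists (co b s); last by exists (co b T) => //; exact: IH.
by case: (b); apply/imfsetP; exists s.
Qed.

End carpet.

(** For equal ratios, the inverse of f composed with g is the translation by (g.2 - f.2) / ratio f,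
    and isolation of the identity keeps a nonzero one away from 0. *)
Lemma weak_separation_gap (R : realType) (F : {fset affine1 R}) :
  weak_separation F -> exists2 e : R, 0 < e &
    forall f g, all_compositions F f -> all_compositions F g ->
      0 < ratio f -> ratio f = ratio g -> f.2 != g.2 ->
      e * ratio f <= `|f.2 - g.2|.
Proof.
move=> [_ [V /nbhs_ballP[e /= e0 eV] VE]]; exists e => // f g Ff Fg f0 fg.
apply: contraR; rewrite -ltNge => fge.
pose T := affine_comp (affine_inv f) g.
have TE : T = (1, (g.2 - f.2) / f.1).
  congr pair => /=; first by rewrite -[g.1]/(ratio g) -fg mulVf// gt_eqF.
  by rewrite mulrBl mulrC [f.2 / _]mulrC.
have VT : V T.
  apply: eV; rewrite TE; split; rewrite /ball /= ?subrr ?normr0//.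
  rewrite sub0r normrN normrM normfV (gtr0_norm f0) ltr_pdivrMr//.
  by rewrite distrC.
have : (V `&` [set T | exists S S', [/\ all_compositions F S,
  all_compositions F S' & T = affine_comp (affine_inv S) S']]) T.
  by split => //; exists f, g.
rewrite VE => /= ; rewrite TE => -[] /eqP.
rewrite mulf_eq0 invr_eq0 (gt_eqF f0) orbF subr_eq0 => /eqP ->.
by rewrite eqxx.
Qed.

(** What both separation hypotheses provide. The fast gap is required only inside a row, because the
    rectangular open set condition separates rectangles and not their first projections. *)
Definition fold_gap (R : realType) (G : {fset diagonal_map R}) (b : bool)
    (e : R) : Prop := forall n S T, (0 < n)%N ->
  S \in n_fold G n -> T \in n_fold G n ->
  (ratio (co (~~ b) S) = ratio (co (~~ b) T) ->
   (co (~~ b) S).2 != (co (~~ b) T).2 ->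
   e * ratio (co (~~ b) S) <= `|(co (~~ b) S).2 - (co (~~ b) T).2|) /\
  (co (~~ b) S = co (~~ b) T -> ratio (co b S) = ratio (co b T) ->
   (co b S).2 != (co b T).2 ->
   e * ratio (co b S) <= `|(co b S).2 - (co b T).2|).

(** * Gaps of compositions under either separation hypothesis *)

Section gaps.
Context {R : realType} (G : {fset diagonal_map R}) (L : set (R * R)).
Hypothesis G_pos : orientation_preserving G.
Hypothesis G_carpet : self_affine_carpet G.
Hypothesis G_attractor : is_attractor G L.
Hypothesis L_normalized : normalized L.

Let facts := n_fold_facts G_pos G_carpet G_attractor L_normalized.

Let wsc_gap b : weak_separation (projected G b) -> exists2 e : R, 0 < e &
  forall n S T, (0 < n)%N -> S \in n_fold G n -> T \in n_fold G n ->
  ratio (co b S) = ratio (co b T) -> (co b S).2 != (co b T).2 ->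
  e * ratio (co b S) <= `|(co b S).2 - (co b T).2|.
Proof.
move=> /weak_separation_gap[e e0 eP]; exists e => // n S T n0 Sn Tn.
apply: eP; [by exists n => //; exact: n_fold_projected ..|].
by case: (facts Sn).
Qed.

Lemma fold_gap_weak_separation b :
  weak_separation (projected G b) -> weak_separation (projected G (~~ b)) ->
  exists2 e : R, 0 < e & fold_gap G b e.
Proof.
move=> /wsc_gap[e e0 eP] /wsc_gap[f f0 fP]; exists (Num.min e f).
  by rewrite lt_min e0.
move=> n S T n0 Sn Tn; have [S0 _ _] := facts Sn; split=> [h1 h2|_ h1 h2].
  apply: le_trans (fP _ _ _ n0 Sn Tn h1 h2).
  by rewrite ler_wpM2r ?ge_min ?lexx ?orbT// ltW.
apply: le_trans (eP _ _ _ n0 Sn Tn h1 h2).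
by rewrite ler_wpM2r ?ge_min ?lexx// ltW.
Qed.

Let in_square (u : R * R) := forall b, 0 < co b u < 1.

Let square_n_fold n S u : S \in n_fold G n -> in_square u ->
  in_square (diagonal_eval S u).
Proof.
move=> Sn hu b; have [r0 _ t01] := facts Sn; rewrite co_eval /affine_eval.
have := hu b => /andP[u0 u1]; have := r0 b; have /andP[t0 t1] := t01 b => {}r0.
have := mulr_gt0 r0 u0; have : ratio (co b S) * co b u < ratio (co b S).
  by rewrite gtr_pMr.
by rewrite /ratio in t1 * => h1 h2; apply/andP; split; lra.
Qed.

Let diagonal_eval_inj n S u v : S \in n_fold G n ->
  diagonal_eval S u = diagonal_eval S v -> u = v.
Proof.
move=> Sn; have [r0 _ _] := facts Sn; case: u v => [u1 u2] [v1 v2].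
rewrite /diagonal_eval /affine_eval /= => -[/addIr h1 /addIr h2].
congr pair.
  by apply: mulfI h1; rewrite gt_eqF//; exact: (r0 true).
by apply: mulfI h2; rewrite gt_eqF//; exact: (r0 false).
Qed.

(** A common first letter cancels by injectivity. Different first letters have disjoint images of
    the open square, which compositions map into itself. *)
Let rosc_n_fold n S T u v : rectangular_osc G ->
  S \in n_fold G n -> T \in n_fold G n -> S <> T ->
  in_square u -> in_square v -> diagonal_eval S u <> diagonal_eval T v.
Proof.
move=> rosc; elim: n S T => [|n IH] S T.
  by rewrite !inE => /eqP -> /eqP ->.
move=> /n_foldP[s [S' [sG S'G ->]]] /n_foldP[t [T' [tG T'G ->]]] ST hu hv.
rewrite !diagonal_compE /= => E.
have fold1 x : x \in G -> x \in n_fold G 1.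
  move=> xG; apply/n_foldP; exists x, diagonal_id; split=> //; first by rewrite inE.
  case: x xG => [[a1 a2] [b1 b2]] _.
  by rewrite /diagonal_comp /affine_comp /= !mulr1 !mulr0 !add0r.
have [st|/eqP st] := eqVneq s t.
  subst t; apply: (IH S' T' S'G T'G) hu hv _; first by move=> ST'; apply: ST; rewrite ST'.
  exact: diagonal_eval_inj (fold1 _ sG) E.
have hS := square_n_fold S'G hu; have hT := square_n_fold T'G hv.
have sq w : in_square w -> (`]0, 1[ `*` `]0, 1[)%classic w.
  by move=> hw; split; rewrite /= in_itv; [exact: (hw true)|exact: (hw false)].
have := rosc s t sG tG st; rewrite -subset0 => /(_ (diagonal_eval s (diagonal_eval S' u))).
apply; split; first by exists (diagonal_eval S' u) => //; exact: sq.
by rewrite E; exists (diagonal_eval T' v) => //; exact: sq.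
Qed.

(** Two maps of one row with the same ratio r send the open square to horizontal translates of one
    rectangle of width r, which overlap if the shift is less than r. *)
Lemma fold_gap_rectangular_osc :
  rectangular_osc G -> weak_separation (projected G false) ->
  exists2 e : R, 0 < e & fold_gap G true e.
Proof.
move=> rosc /wsc_gap[e e0 eP]; exists (Num.min e 1); first by rewrite lt_min e0 ltr01.
move=> n S T n0 Sn Tn; have [S0 _ _] := facts Sn; split=> [h1 h2|E2 h1 h2].
  apply: le_trans (eP _ _ _ n0 Sn Tn h1 h2).
  by rewrite ler_wpM2r ?ge_min ?lexx// ltW//; exact: (S0 false).
have r0 := S0 true; rewrite -[leRHS]mul1r.
apply: (@le_trans _ _ (1 * ratio (co true S))).
  by rewrite ler_wpM2r ?ge_min ?lexx ?orbT// ltW.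
rewrite !mul1r leNgt; apply/negP => lt_r.
set r := ratio (co true S) in h1 r0 lt_r.
pose d := (T.1.2 - S.1.2) / r.
have d1 : - 1 < d < 1.
  rewrite -ltr_norml /d normrM normfV (gtr0_norm r0) ltr_pdivrMr// mul1r.
  by rewrite distrC.
(* Since d is the shift in units of r, S sends the first point where T sends the second. *)
apply: (@rosc_n_fold n S T ((1 + d) / 2, 1 / 2) ((1 - d) / 2, 1 / 2)) => //.
- by move=> ST; move: h2; rewrite ST eqxx.
- by move/andP: d1 => [d1 d2]; case=> /=; apply/andP; split; lra.
- by move/andP: d1 => [d1 d2]; case=> /=; apply/andP; split; lra.
congr pair; rewrite /affine_eval /=; last by rewrite [S.2]E2.
rewrite -![_.1.1]/(ratio (co true _)) -h1 -/r /d; field.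
by rewrite gt_eqF.
Qed.

End gaps.

(** * Lower bound *)

(** m / k rounded up: what is left of m elements when every k-th is kept, starting with the
    first. *)
Definition cdiv (m k : nat) := ((m + k.-1) %/ k)%N.

Lemma cdiv_bounds m k : (0 < k)%N ->
  (cdiv m k * k < m + k)%N /\ (m <= cdiv m k * k)%N.
Proof.
move=> k0; split.
  apply: leq_ltn_trans (leq_trunc_div _ _) _.
  by rewrite ltn_add2l prednK.
have := ltn_ceil (m + k.-1) k0; rewrite -/(cdiv m k) mulSn.
by move: (cdiv m k * k)%N => q; lia.
Qed.

Lemma cdiv_gt0 m k : (0 < k)%N -> (0 < m)%N -> (0 < cdiv m k)%N.
Proof.
move=> k0 m0; have [_] := cdiv_bounds m k0.
by apply: contraTT; rewrite -leqNgt leqn0 => /eqP ->; rewrite -ltnNge.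
Qed.

Lemma ln_cdiv (R : realType) m k : (0 < k)%N -> (0 < m)%N ->
  ln m%:R <= ln (cdiv m k)%:R + ln k%:R :> R.
Proof.
move=> k0 m0; have c0 := cdiv_gt0 k0 m0.
rewrite -lnM ?posrE ?ltr0n// -natrM ler_ln ?posrE ?ltr0n ?muln_gt0 ?c0//.
by rewrite ler_nat; case: (cdiv_bounds m k0).
Qed.

Section fold_words.
Context {R : realType} (G : {fset diagonal_map R}).

Definition comp_word (w : seq G) : diagonal_map R :=
  foldr (fun g S => diagonal_comp (val g) S) diagonal_id w.

Lemma n_fold_word n S : S \in n_fold G n ->
  exists w : n.-tuple G, S = comp_word w.
Proof.
elim: n S => [|n IH] S; first by rewrite inE => /eqP ->; exists [tuple].
by move=> /n_foldP[s [T [sG /IH[w ->] ->]]]; exists [tuple of [` sG]%fset :: w].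
Qed.

Lemma ratio_comp_word b w :
  ratio (co b (comp_word w)) = \prod_(g <- w) ratio (co b (val g)).
Proof.
elim: w => [|g w IH]; first by rewrite big_nil; case: b.
by rewrite big_cons /= co_comp -IH.
Qed.

Lemma ln_ratio_le : self_affine_carpet G -> orientation_preserving G ->
  exists2 c : R, 0 < c & forall n b S, S \in n_fold G n ->
    n%:R * c <= - ln (ratio (co b S)).
Proof.
move=> Gc Gp; have r01 b (g : G) := ratio_G Gp Gc b (valP g).
have [c c0 cP] : exists2 c : R, 0 < c & forall b (g : G), c <= - ln (ratio (co b (val g))).
  pose m := \big[Order.min/1]_(x : bool * G) (- ln (ratio (co x.1 (val x.2)))).
  exists m => [|b g]; last by rewrite /m (bigD1 (b, g))//= ge_min lexx.
  by apply: lt_bigmin => // -[b g] _ /=; rewrite oppr_gt0 ln_lt0 ?r01.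
exists c => // n b S /n_fold_word[w ->]; rewrite ratio_comp_word.
rewrite -[X in X%:R * _](size_tuple w).
elim: (tval w) => [|g v IH]; first by rewrite big_nil ln1 mul0r oppr0.
rewrite big_cons lnM ?posrE ?prodr_gt0//; last 2 first.
- by case/andP: (r01 b g).
- by move=> i _; case/andP: (r01 b i).
by have := cP b g; rewrite /= -addn1 natrD; lra.
Qed.

End fold_words.

(** * Grids inside the classes of n-fold compositions *)

Section class_grids.
Context {R : realType} (G : {fset diagonal_map R}) (L : set (R * R)).
Hypothesis G_pos : orientation_preserving G.
Hypothesis G_carpet : self_affine_carpet G.
Hypothesis G_attractor : is_attractor G L.
Hypothesis L_normalized : normalized L.
Context (b : bool) (e : R) (n : nat).
Hypothesis e_gt0 : 0 < e.
Hypothesis gapG : fold_gap G b e.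
Hypothesis n_gt0 : (0 < n)%N.
Context (m : nat).
Hypothesis m_gt0 : (0 < m)%N.
Hypothesis me_ge1 : 1 <= m%:R * e.

Let facts := n_fold_facts G_pos G_carpet G_attractor L_normalized.

Local Notation F := (n_fold G n).
Local Notation P := [fset co (~~ b) S | S in F]%fset.

(** The row of S, as an element of a finite type so that marginals over rows are finite sums. *)
Definition fold_proj (S : F) : P :=
  [` in_imfset imfset_key (fun S : diagonal_map R => co (~~ b) S) (valP S)]%fset.

Lemma fold_projE (S T : F) :
  (fold_proj S == fold_proj T) = (co (~~ b) (val S) == co (~~ b) (val T)).
Proof. by rewrite -val_eqE. Qed.

Variable word : F -> n.-tuple G.
Hypothesis wordP : forall S : F, val S = comp_word (word S).

(** Ratios multiply, so they depend only on these counts, which take polynomially many values in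
    n. *)
Definition letter_counts (S : F) : {ffun G -> 'I_n.+1} :=
  [ffun g => inord (count_mem g (word S))].

Lemma letter_counts_ratio S T b' : letter_counts S = letter_counts T ->
  ratio (co b' (val S)) = ratio (co b' (val T)).
Proof.
move=> ST; rewrite !wordP !ratio_comp_word; apply: perm_big.
rewrite /perm_eq; apply/allP => g _; have := congr1 (fun f : {ffun G -> 'I_n.+1} => f g : nat) ST.
have le_n (U : F) : (count_mem g (word U) < n.+1)%N.
  by rewrite ltnS (leq_trans (count_size _ _))// size_tuple.
by rewrite !ffunE !inordK// => E; exact/eqP.
Qed.

Definition fold_fiber (S : F) := [pred T : F |
  (fold_proj T == fold_proj S) && (letter_counts T == letter_counts S)].

(** Crude, but it confines the binary logarithm of a fibre size to linearly many values in n. *)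
Lemma fold_fiber_card S : (#|fold_fiber S| <= 2 ^ (n * #|{: G}|))%N.
Proof.
apply: leq_trans (max_card _) _.
have word_inj : injective word by move=> S1 S2 E; apply: val_inj; rewrite !wordP E.
apply: leq_trans (leq_card _ word_inj) _.
rewrite card_tuple mulnC expnM leq_exp2r//; apply: ltnW; exact: ltn_expl.
Qed.

(* The fibre sizes are only recorded up to a factor 2, which keeps the number
   of classes polynomial in n. *)
Definition fold_class (S : F) : {ffun G -> 'I_n.+1} * 'I_(n * #|{: G}|).+1 :=
  (letter_counts S, inord (trunc_log 2 #|fold_fiber S|)).

Lemma fold_fiber_gt0 S : (0 < #|fold_fiber S|)%N.
Proof. by apply/card_gt0P; exists S; rewrite inE !eqxx. Qed.

Lemma fold_class_log S :
  (fold_class S).2 = trunc_log 2 #|fold_fiber S| :> nat.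
Proof.
rewrite inordK// ltnS -(@leq_exp2l 2)//.
by apply: leq_trans (fold_fiber_card S); apply: trunc_logP => //; exact: fold_fiber_gt0.
Qed.

Lemma fold_fiber_lt S : (#|fold_fiber S| < 2 ^ ((fold_class S).2).+1)%N.
Proof. by rewrite fold_class_log trunc_log_ltn. Qed.

Lemma fold_fiber_ge S T : fold_class S = fold_class T ->
  (2 ^ (fold_class S).2 <= #|fold_fiber T|)%N.
Proof.
by move=> ->; rewrite fold_class_log; apply: trunc_logP => //; exact: fold_fiber_gt0.
Qed.

(** By [gapG], distinct slow translations in a class, and fast ones in a fibre, are at least e times
    the ratio apart; every m-th of them is a full ratio apart since m e >= 1. All rows need equally
    many columns, hence the power of 2 below the fibre sizes. *)
Lemma fold_class_grid (S : F) : has_grid L b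
  (ln (cdiv (2 ^ (fold_class S).2) m)%:R)
  (ln (cdiv (row_card fold_proj fold_class (fold_class S)) m)%:R)
  (- ln (ratio (co b (val S)))) (- ln (ratio (co (~~ b) (val S)))).
Proof.
have [S0 _ _] := facts (valP S).
have class_ratio T b' : fold_class T = fold_class S ->
    ratio (co b' (val T)) = ratio (co b' (val S)).
  by move=> [/letter_counts_ratio ->].
set rows := row_card _ _ _; set cols := (2 ^ _)%N.
set ratf := ratio (co b (val S)); set rats := ratio (co (~~ b) (val S)).
pose Rw := [pred j : P | [exists T, (fold_proj T == j) && (fold_class T == fold_class S)]].
have RwP (j : P) : j \in Rw -> exists2 T, fold_class T = fold_class S & fold_proj T = j.
  by rewrite inE => /existsP[T /andP[/eqP Tj /eqP TS]]; exists T.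
have me1 (r : R) : 0 < r -> r <= m%:R * (e * r).
  by move=> r0; rewrite mulrA ler_peMl// ltW.
have [f [fP fsep]] : exists f : 'I_(cdiv rows m) -> R,
    (forall i, exists2 T, fold_class T = fold_class S & (co (~~ b) (val T)).2 = f i) /\
    forall i i', i != i' -> rats <= `|f i - f i'|.
  have [|||||f [fP fsep]] := @separated_subfamily R
    [seq (val j).2 | j <- enum Rw] (e * rats) rats m (cdiv rows m).
  - rewrite map_inj_in_uniq ?enum_uniq// => j j'; rewrite !mem_enum.
    move=> /RwP[T TS <-] /RwP[T' TS' <-] E; apply/eqP; rewrite fold_projE.
    have := class_ratio T (~~ b) TS; rewrite -(class_ratio T' (~~ b) TS').
    move: E => /=; rewrite /ratio; case: (co _ _) => r t; case: (co _ _) => r' t' /=.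
    by move=> -> ->.
  - by rewrite mulr_ge0// ltW//; exact: S0.
  - move=> _ _ /mapP[j + ->] /mapP[j' + ->]; rewrite !mem_enum.
    move=> /RwP[T TS <-] /RwP[T' TS' <-] ne.
    rewrite /rats -(class_ratio T _ TS).
    have [+ _] := gapG n_gt0 (valP T) (valP T'); apply=> //.
    by rewrite !class_ratio.
  - by apply: me1; exact: S0.
  - by rewrite size_map -cardE; case: (cdiv_bounds rows m_gt0).
  exists f; split=> // i; have /mapP[j] := fP i; rewrite mem_enum => /RwP[T TS <-] ->.
  by exists T.
have /choice[Ti TiP] i : exists T, fold_class T = fold_class S /\ (co (~~ b) (val T)).2 = f i.
  by have [T ? ?] := fP i; exists T.
have /choice[s sP] i : exists s : 'I_(cdiv cols m) -> F,
    (forall j, s j \in fold_fiber (Ti i)) /\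
    forall j j', j != j' -> ratf <= `|(co b (val (s j))).2 - (co b (val (s j'))).2|.
  have fibP T : T \in fold_fiber (Ti i) ->
      co (~~ b) (val T) = co (~~ b) (val (Ti i)) /\ ratio (co b (val T)) = ratf.
    rewrite inE => /andP[]; rewrite fold_projE => /eqP -> /eqP /letter_counts_ratio ->.
    by split=> //; apply: class_ratio; case: (TiP i).
  have [|||||g [gP gsep]] := @separated_subfamily R
    [seq (co b (val T)).2 | T <- enum (fold_fiber (Ti i))] (e * ratf) ratf m (cdiv cols m).
  - rewrite map_inj_in_uniq ?enum_uniq// => T T'; rewrite !mem_enum.
    move=> /fibP[sT fT] /fibP[sT' fT'] E; apply: val_inj.
    have sE : co (~~ b) (val T) = co (~~ b) (val T') by rewrite sT sT'.
    have fE : co b (val T) = co b (val T').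
      move: E fT; rewrite -fT' /ratio; case: (co b _) => r t; case: (co b _) => r' t' /=.
      by move=> -> ->.
    by move: sE fE; case: (b); case: (val T) => ? ?; case: (val T') => ? ? /= -> ->.
  - by rewrite mulr_ge0// ltW//; exact: S0.
  - move=> _ _ /mapP[T + ->] /mapP[T' + ->]; rewrite !mem_enum.
    move=> /fibP[sT fT] /fibP[sT' fT'] ne; rewrite -fT.
    have [_ +] := gapG n_gt0 (valP T) (valP T'); apply=> //.
      by rewrite sT sT'.
    by rewrite fT fT'.
  - by apply: me1; exact: S0.
  - rewrite size_map -cardE; have [lt_c _] := cdiv_bounds cols m_gt0.
    apply: leq_trans lt_c _; rewrite leq_add2r fold_fiber_ge//.
    by case: (TiP i).
  have /choice[s sP] j : exists T, T \in fold_fiber (Ti i) /\ (co b (val T)).2 = g j.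
    by have /mapP[T + ->] := gP j; rewrite mem_enum => Tf; exists T.
  exists s; split=> j; first by case: (sP j).
  by move=> j' jj'; rewrite (sP j).2 (sP j').2 gsep.
have sclass i j : letter_counts (s i j) = letter_counts S.
  have [/(_ j) + _] := sP i; rewrite inE => /andP[_ /eqP ->].
  by have [[]] := TiP i.
have sslow i j : co (~~ b) (val (s i j)) = co (~~ b) (val (Ti i)).
  by have [/(_ j) + _] := sP i; rewrite inE => /andP[+ _]; rewrite fold_projE => /eqP.
have expE b' : expR (- - ln (ratio (co b' (val S)))) = ratio (co b' (val S)).
  by rewrite opprK lnK// posrE; exact: S0.
exists 'I_(cdiv rows m), 'I_(cdiv cols m), (fun i j => val (s i j)).
rewrite !card_ord; split=> //.
- split.
  + by move=> i j z Lz; have [_ + _] := facts (valP (s i j)); apply.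
  + by move=> i j b'; have [_ _] := facts (valP (s i j)); apply.
  + by move=> i j; rewrite expE; apply: letter_counts_ratio.
  + by move=> i j; rewrite expE; apply: letter_counts_ratio.
  + by move=> i j j'; rewrite !sslow.
  + by move=> i i' j j' ii'; rewrite expE !sslow (TiP i).2 (TiP i').2 fsep.
  + by move=> i j j' jj'; rewrite expE; have [_] := sP i; apply.
- by apply: cdiv_gt0 => //; exact: row_card_gt0.
- by apply: cdiv_gt0 => //; rewrite expn_gt0.
Qed.

End class_grids.

Section branches.
Context {R : realType}.
Implicit Types F : {fset diagonal_map R}.

Definition D_branch F (b : bool) (p : {ffun F -> R}) : R :=
  let lf := log_contraction p (co b) in
  let ls := log_contraction p (co (~~ b)) in
  let h := marginal_entropy_sum p (co (~~ b)) in
  entropy_sum p / lf + h / ls - h / lf.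

Lemma D_BA_branch F (p : {ffun F -> R}) : D_BA p =
  D_branch (0 <= \sum_(S : F) p S * ln (ratio (val S).2 / ratio (val S).1)) p.
Proof. by rewrite /D_BA; case: ifP. Qed.

Lemma marginal_entropy_sumE F (p : {ffun F -> R}) pr :
  marginal_entropy_sum p pr =
  \sum_(S : F) p S * ln (marginal p pr (pr (val S))).
Proof.
rewrite /marginal_entropy_sum /xlogx.
under eq_bigr do rewrite {1}/marginal big_distrl/= big_mkcond/=.
rewrite exchange_big/=; apply: eq_bigr => S _.
rewrite (big_fsetD1 (pr (val S)))/= ?eqxx; last first.
  by apply/imfsetP; exists (val S) => //; exact: valP.
rewrite big1_fset ?addr0// => f; rewrite !inE => /andP[fS _] _.
by rewrite ifN// eq_sym.
Qed.

End branches.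

Section lower_bound.
Context {R : realType} (G : {fset diagonal_map R}) (L : set (R * R)).
Hypothesis G_pos : orientation_preserving G.
Hypothesis G_carpet : self_affine_carpet G.
Hypothesis G_attractor : is_attractor G L.
Hypothesis L_normalized : normalized L.

Definition class_number n := ((n.+1 ^ #|{: G}|) * (n * #|{: G}|).+1)%N.

(** The two entropies are bounded by mean logarithms of cardinalities, these by the class grids, and
    the grids are mixed with weights p, one for each map. Each entropy costs [ln (class_number n)],
    each thinning costs [ln m], and [ln 2] is the rounding of fibre sizes. *)
Lemma D_branch_le b (e c t : R) n m (p : {ffun n_fold G n -> R}) :
  0 < e -> fold_gap G b e -> (0 < n)%N -> (0 < m)%N -> 1 <= m%:R * e ->
  0 < c -> (forall b S, S \in n_fold G n -> n%:R * c <= - ln (ratio (co b S))) ->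
  0 <= t -> hausdorff_measure t L = 0%E ->
  probability_vectors p ->
  D_branch b p <= t +
    (2 * ln (class_number n)%:R + 2 * ln m%:R + ln 2) / (n%:R * c).
Proof.
move=> e0 gap n0 m0 me c0 cP t0 Ht [p0 p1].
have [word wordP] : exists word : n_fold G n -> n.-tuple G,
    forall S : n_fold G n, val S = comp_word (word S).
  by have [w wP] := choice (fun S : n_fold G n => n_fold_word (valP S)); exists w.
have [L0 cL _] := G_attractor.
pose r := @fold_proj R G b n; pose k := fold_class b word.
pose x S : R := ln (cdiv (2 ^ (k S).2) m)%:R.
pose y S : R := ln (cdiv (row_card r k (k S)) m)%:R.
pose a (S : n_fold G n) := - ln (ratio (co b (val S))).
pose d (S : n_fold G n) := - ln (ratio (co (~~ b) (val S))).
have g S : has_grid L b (x S) (y S) (a S) (d S).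
  exact: (fold_class_grid G_pos G_carpet G_attractor L_normalized e0 gap n0 m0 me wordP).
have nc0 : 0 < n%:R * c by rewrite mulr_gt0// ltr0n.
have a_ge S : n%:R * c <= a S by apply: cP; exact: valP.
have d_ge S : n%:R * c <= d S by apply: cP; exact: valP.
have ln_cdiv_ge0 u : (0 < u)%N -> 0 <= ln (cdiv u m)%:R :> R.
  by move=> u0; rewrite ln_ge0// ler1n cdiv_gt0.
have x0 S : 0 <= x S by apply: ln_cdiv_ge0; rewrite expn_gt0.
have y0 S : 0 <= y S by apply: ln_cdiv_ge0; exact: row_card_gt0.
have := has_grid_mixture cL L0 t0 Ht p0 p1
  (fun S => lt_le_trans nc0 (a_ge S)) (fun S => lt_le_trans nc0 (d_ge S)) x0 y0 g.
have hc := cond_entropy_le r k p0 p1; have hm := marg_entropy_le r k p0 p1.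
have mean_const (q : R) : \sum_S p S * q = q by rewrite -mulr_suml p1 mul1r.
have mean_ge (q : R) (u : n_fold G n -> R) :
    (forall S, q <= u S) -> q <= \sum_S p S * u S.
  move=> ug; rewrite -[leLHS]mean_const; apply: ler_sum => S _.
  by rewrite ler_wpM2l.
have mean_leD (q : R) (u v : n_fold G n -> R) : (forall S, u S <= v S + q) ->
    \sum_S p S * u S <= \sum_S p S * v S + q.
  move=> uv; rewrite -[X in _ + X]mean_const -big_split/=; apply: ler_sum => S _.
  by rewrite -mulrDr ler_wpM2l.
have A0 := mean_ge _ _ a_ge; have B0 := mean_ge _ _ d_ge.
have lE b' : log_contraction p (co b') =
    - \sum_S p S * (- ln (ratio (co b' (val S)))).
  by rewrite -sumrN; apply: eq_bigr => S _; rewrite mulrN opprK.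
have mE : marginal_entropy_sum p (co (~~ b)) = \sum_S p S * ln (marg r p (r S)).
  rewrite marginal_entropy_sumE; apply: eq_bigr => S _; congr (_ * ln _).
have xle : \sum_S p S * ln (fiber_card r k S)%:R <=
    \sum_S p S * x S + (ln m%:R + ln 2).
  apply: mean_leD => S; rewrite addrA.
  apply: (@le_trans _ _ (ln (2 ^ (k S).2.+1)%:R)).
    rewrite ler_ln ?posrE ?ltr0n ?fiber_card_gt0 ?expn_gt0// ler_nat.
    apply: ltnW; apply: leq_ltn_trans (fold_fiber_lt b n0 wordP S).
    apply: subset_leq_card; apply/fintype.subsetP => T; rewrite !inE.
    by move=> /andP[-> /eqP [->]]; rewrite eqxx.
  rewrite expnS mulnC natrM lnM ?posrE ?ltr0n ?expn_gt0// lerD2r.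
  by apply: ln_cdiv => //; rewrite expn_gt0.
have yle : \sum_S p S * ln (row_card r k (k S))%:R <= \sum_S p S * y S + ln m%:R.
  by apply: mean_leD => S; apply: ln_cdiv => //; exact: row_card_gt0.
have TE : #|{: {ffun G -> 'I_n.+1} * 'I_(n * #|{: G}|).+1}| = class_number n.
  by rewrite card_prod card_ffun !card_ord.
rewrite TE in hc hm.
rewrite /D_branch !lE mE /entropy_sum -/a -/d.
set H := \sum_S xlogx _; set H2 := \sum_S p S * ln (marg _ _ _).
set A := \sum_S p S * a S in A0 *; set B := \sum_S p S * d S in B0 *.
set X := \sum_S p S * x S in xle *; set Y := \sum_S p S * y S in yle *.
rewrite -[\sum_i p i * ln (p i)]/H -/H2 in hc; rewrite -/H2 in hm.
have lnT0 : 0 <= ln (class_number n)%:R :> R.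
  by rewrite ln_ge0// ler1n muln_gt0 expn_gt0.
have lnm0 : 0 <= ln m%:R :> R by rewrite ln_ge0// ler1n.
have ln20 : 0 <= ln 2 :> R by rewrite ln_ge0// ler1n.
have Apos := lt_le_trans nc0 A0; have Bpos := lt_le_trans nc0 B0.
move: (ln (class_number n)%:R) (ln m%:R) (ln 2) lnT0 lnm0 ln20 hc hm xle yle.
move=> lT lm l2 lT0 lm0 l20 hc hm xle yle h.
have -> : H / - A + H2 / - B - H2 / - A = (- H + H2) / A + - H2 / B.
  by field; rewrite !gt_eqF.
have err (u V : R) : 0 <= u -> n%:R * c <= V -> u / V <= u / (n%:R * c).
  by move=> u0 V0; rewrite ler_wpM2l// lef_pV2// posrE// (lt_le_trans nc0).
have h1 : (- H + H2) / A <= X / A + (lT + lm + l2) / (n%:R * c).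
  apply: (@le_trans _ _ ((X + (lT + lm + l2)) / A)).
    by rewrite ler_pM2r ?invr_gt0//; lra.
  by rewrite mulrDl lerD2l err//; lra.
have h2 : - H2 / B <= Y / B + (lT + lm) / (n%:R * c).
  apply: (@le_trans _ _ ((Y + (lT + lm)) / B)).
    by rewrite ler_pM2r ?invr_gt0//; lra.
  by rewrite mulrDl lerD2l err//; lra.
apply: le_trans (lerD h1 h2) _.
rewrite (_ : (2 * lT + 2 * lm + l2) / (n%:R * c) =
  (lT + lm + l2) / (n%:R * c) + (lT + lm) / (n%:R * c)); last first.
  by rewrite -mulrDl; congr (_ / _); ring.
by move: h; rewrite -/X -/Y; lra.
Qed.

End lower_bound.

(** * Counting words by frequencies *)

Section type_sum.
Context {R : realType} (I J : finType) (r : I -> J).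

(* When c = 0 the division by zero makes this the zero vector, so that it is a
   subprobability in all cases. *)
Definition frequency (A : finType) (c : A -> nat) (i : A) : R :=
  (c i)%:R / (\sum_j c j)%:R.

Lemma frequency_ge0 (A : finType) (c : A -> nat) i : 0 <= frequency c i.
Proof. by rewrite divr_ge0. Qed.

Lemma frequency_sum_le1 (A : finType) (c : A -> nat) : \sum_i frequency c i <= 1.
Proof.
rewrite -mulr_suml -natr_sum; have [->|c0] := eqVneq (\sum_j c j)%N 0%N.
  by rewrite mul0r ler01.
by rewrite mulfV// pnatr_eq0.
Qed.

(** Draw a row by the frequencies d, then a letter of that row by the conditional frequencies of c.
    Later c counts the first n letters and d the first n + k rows. *)
Definition letter_weight (c : I -> nat) (d : J -> nat) (i : I) : R :=
  frequency c i / marg r (frequency c) (r i) * frequency d (r i).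

Lemma letter_weight_ge0 c d i : 0 <= letter_weight c d i.
Proof.
rewrite mulr_ge0 ?frequency_ge0// divr_ge0 ?frequency_ge0//.
by apply: sumr_ge0 => ? _; exact: frequency_ge0.
Qed.

Lemma letter_weight_sum c d : \sum_i letter_weight c d i <= 1.
Proof.
apply: le_trans (frequency_sum_le1 d); rewrite (partition_big r predT)//=.
apply: ler_sum => j _.
rewrite (eq_bigr (fun i => frequency c i * (frequency d j / marg r (frequency c) j))); last first.
  by move=> i /eqP ij; rewrite /letter_weight ij mulrAC mulrA.
rewrite -mulr_suml -/(marg r (frequency c) j) mulrCA.
have [->|q0] := eqVneq (marg r (frequency c) j) 0.
  by rewrite invr0 !mulr0 frequency_ge0.
by rewrite mulfV// mulr1.
Qed.

Context (n k : nat).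
Implicit Types (w : {ffun 'I_n -> I}) (v : {ffun 'I_k -> J}).

Definition word_count (A : finType) l (w : {ffun 'I_l -> A}) (a : A) : nat :=
  \sum_(t < l) (w t == a).

Definition row_count w v j : nat :=
  (\sum_(t < n) (r (w t) == j) + \sum_(t < k) (v t == j))%N.

(** The likelihood of n letters followed by k rows under the frequencies of this very code. *)
Definition word_weight w v : R :=
  (\prod_(t < n) letter_weight (word_count w) (row_count w v) (w t)) *
  \prod_(t < k) frequency (row_count w v) (v t).

Lemma sum_bool_le (A : Type) l (P : pred 'I_l) : (\sum_(t < l) P t <= l)%N.
Proof.
rewrite -[X in (_ <= X)%N]card_ord -sum1_card; apply: leq_sum => t _.
by case: (P t).
Qed.

(** For fixed count vectors the weights are products of subprobabilities and sum to at most 1; the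
    right side counts the pairs of count vectors. *)
Lemma sum_word_weight :
  \sum_w \sum_v word_weight w v <= (n.+1 ^ #|I| * (n + k).+1 ^ #|J|)%:R.
Proof.
pose T := ({ffun I -> 'I_n.+1} * {ffun J -> 'I_(n + k).+1})%type.
pose f (u : T) w v : R :=
  (\prod_(t < n) letter_weight (fun i => u.1 i : nat) (fun j => u.2 j : nat) (w t)) *
  \prod_(t < k) frequency (fun j => u.2 j : nat) (v t).
have f0 u w v : 0 <= f u w v.
  by rewrite mulr_ge0// prodr_ge0// => t _; rewrite ?letter_weight_ge0 ?frequency_ge0.
apply: (@le_trans _ _ (\sum_w \sum_v \sum_u f u w v)).
  apply: ler_sum => w _; apply: ler_sum => v _.
  pose c : {ffun I -> 'I_n.+1} := [ffun i => inord (word_count w i)].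
  pose d : {ffun J -> 'I_(n + k).+1} := [ffun j => inord (row_count w v j)].
  have cE : (fun i => c i : nat) = word_count w.
    by apply/funext => i; rewrite ffunE inordK// ltnS sum_bool_le.
  have dE : (fun j => d j : nat) = row_count w v.
    by apply/funext => j; rewrite ffunE inordK// ltnS leq_add// sum_bool_le.
  by rewrite (bigD1 (c, d))//= {1}/f /= cE dE lerDl sumr_ge0.
under eq_bigr do rewrite exchange_big/=.
rewrite exchange_big/=.
apply: (@le_trans _ _ (\sum_(u : T) 1)); last first.
  by rewrite sumr_const card_prod !card_ffun !card_ord.
apply: ler_sum => u _; rewrite /f.
have distr (A : finType) l (g : A -> R) :
    \sum_(x : {ffun 'I_l -> A}) \prod_(t < l) g (x t) = \prod_(t < l) \sum_a g a.
  by rewrite bigA_distr_bigA.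
under eq_bigr do rewrite -mulr_sumr (distr _ _ (frequency _)).
rewrite -mulr_suml (distr _ _ (letter_weight _ _)) mulr_ile1//.
- apply: prodr_ge0 => t _; apply: sumr_ge0 => i _; exact: letter_weight_ge0.
- apply: prodr_ge0 => t _; apply: sumr_ge0 => i _; exact: frequency_ge0.
- apply: prodr_ile1 => t _; rewrite letter_weight_sum andbT.
  by apply: sumr_ge0 => i _; exact: letter_weight_ge0.
- apply: prodr_ile1 => t _; rewrite frequency_sum_le1 andbT.
  by apply: sumr_ge0 => i _; exact: frequency_ge0.
Qed.

End type_sum.

(** * Weights along a sequence of letters *)

Section visits.
Context {R : realType} (I J : finType) (r : I -> J) (o : nat -> I).

Definition visits (A : finType) (x : nat -> A) n (a : A) : nat :=
  \sum_(t < n) (x t == a).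

Lemma visits_sum (A : finType) (x : nat -> A) n : (\sum_a visits x n a = n)%N.
Proof.
rewrite exchange_big/= -[RHS]card_ord -sum1_card; apply: eq_bigr => t _.
by rewrite (bigD1 (x t))//= eqxx big1 ?addn0// => a; rewrite eq_sym => /negbTE ->.
Qed.

Lemma frequency_visits (A : finType) (x : nat -> A) n a :
  @frequency R _ (visits x n) a = (visits x n a)%:R / n%:R.
Proof. by rewrite /frequency visits_sum. Qed.

Lemma visits_mean (A : finType) (x : nat -> A) n (f : A -> R) : (0 < n)%N ->
  \sum_(t < n) f (x t) = n%:R * \sum_a @frequency R _ (visits x n) a * f a.
Proof.
move=> n0; rewrite mulr_sumr.
under [RHS]eq_bigr do
  rewrite frequency_visits mulrA [_%:R * _]mulrC divfK ?pnatr_eq0 -?lt0n//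
    /visits natr_sum mulr_suml.
rewrite exchange_big/=; apply: eq_bigr => t _.
rewrite (bigD1 (x t))//= eqxx mul1r big1 ?addr0// => a.
by rewrite eq_sym => /negbTE ->; rewrite mul0r.
Qed.

Lemma frequency_visits_gt0 (A : finType) (x : nat -> A) n (t : 'I_n) :
  0 < @frequency R _ (visits x n) (x t).
Proof.
rewrite frequency_visits divr_gt0 ?ltr0n//; last by case: n t => [[]|].
by rewrite /visits (bigD1 t)//= eqxx.
Qed.

Lemma frequency_visits_sum (A : finType) (x : nat -> A) n : (0 < n)%N ->
  \sum_a @frequency R _ (visits x n) a = 1.
Proof.
move=> n0; under eq_bigr do rewrite frequency_visits.
by rewrite -mulr_suml -natr_sum visits_sum mulfV// pnatr_eq0 -lt0n.
Qed.

Lemma marg_visits n j :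
  marg r (@frequency R _ (visits o n)) j = @frequency R _ (visits (r \o o) n) j.
Proof.
rewrite /marg; under eq_bigr do rewrite frequency_visits.
rewrite frequency_visits -mulr_suml -natr_sum; congr (_%:R / _).
rewrite exchange_big/=; apply: eq_bigr => t _.
rewrite big_mkcond (bigD1 (o t))//= big1 ?addn0.
  by rewrite eqxx; case: eqP.
by move=> i /negbTE; rewrite eq_sym => ->; case: ifP.
Qed.

Definition neg_entropy n : R :=
  let p := @frequency R _ (visits o n) in \sum_i p i * ln (p i).

Definition neg_marg_entropy n : R :=
  let p := @frequency R _ (visits o n) in \sum_i p i * ln (marg r p (r i)).

(** Under its own frequencies a word has log-likelihood minus its length times its entropy. The
    letters give the conditional entropy at n; their row factors join those of the k further rows to
    give the row entropy at n + k. *)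
Lemma word_weight_visits n k : (0 < n)%N ->
  @word_weight R _ _ r _ _ [ffun t : 'I_n => o t] [ffun t : 'I_k => r (o (n + t)%N)] =
  expR (n%:R * (neg_entropy n - neg_marg_entropy n) +
    (n + k)%:R * neg_marg_entropy (n + k)).
Proof.
move=> n0; have nk0 : (0 < n + k)%N by rewrite ltn_addr.
rewrite /word_weight.
have -> : word_count [ffun t : 'I_n => o t] = visits o n.
  by apply/funext => i; apply: eq_bigr => t _; rewrite ffunE.
have -> : row_count r [ffun t : 'I_n => o t] [ffun t : 'I_k => r (o (n + t)%N)] =
    visits (r \o o) (n + k).
  apply/funext => j; rewrite /row_count /visits big_split_ord/=.
  by congr (_ + _)%N; apply: eq_bigr => t _; rewrite ffunE.
set p := @frequency R _ (visits o n); set q := marg r p.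
set q' := @frequency R _ (visits (r \o o) (n + k)).
have p0 (t : 'I_n) : 0 < p (o t) by exact: frequency_visits_gt0.
have q0 (t : 'I_n) : 0 < q (r (o t)).
  rewrite /q /p marg_visits; exact: (frequency_visits_gt0 (r \o o)).
have q'0 (t : 'I_(n + k)) : 0 < q' (r (o t)).
  exact: (frequency_visits_gt0 (r \o o)).
have -> : \prod_(t < n) letter_weight r (visits o n) (visits (r \o o) (n + k))
      ([ffun t : 'I_n => o t] t) =
    expR (\sum_(t < n) (ln (p (o t)) - ln (q (r (o t)))) +
          \sum_(t < n) ln (q' (r (o t)))).
  rewrite -big_split/= expR_sum; apply: eq_bigr => t _; rewrite ffunE.
  have q't : 0 < q' (r (o t)) := q'0 (lshift k t).
  by rewrite expRD lnK ?posrE// -ln_div ?posrE// lnK// posrE divr_gt0.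
have -> : \prod_(t < k) @frequency R _ (visits (r \o o) (n + k))
      ([ffun t : 'I_k => r (o (n + t)%N)] t) =
    expR (\sum_(t < k) ln (q' (r (o (n + t)%N)))).
  rewrite expR_sum; apply: eq_bigr => t _; rewrite ffunE lnK// posrE.
  exact: (q'0 (rshift n t)).
rewrite -expRD -addrA; congr expR; congr (_ + _).
  rewrite (visits_mean o (fun i => ln (p i) - ln (q (r i))) n0).
  by congr (_ * _); rewrite -sumrB; apply: eq_bigr => i _; rewrite mulrBr.
transitivity (\sum_(t < n + k) ln (q' (r (o t)))); first by rewrite big_split_ord.
rewrite (visits_mean o (fun i => ln (q' (r i))) nk0); congr (_ * _).
by apply: eq_bigr => i _; rewrite marg_visits.
Qed.

Lemma neg_entropy_term_ge (p q : R) : 0 <= p <= q -> q <= 1 -> - 1 <= p * ln q <= 0.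
Proof.
move=> /andP[p0 pq] q1; move: p0; rewrite le_eqVlt => /orP[/eqP <-|p0].
  by rewrite mul0r oppr_le0 ler01 lexx.
have q0 := lt_le_trans p0 pq; rewrite andbC pmulr_rle0// ln_le0//=.
have lpq : ln p <= ln q by rewrite ler_ln// posrE.
apply: (@le_trans _ _ (p * ln p)); last by rewrite ler_pM2l.
have := @le_ln1Dx R (p^-1 - 1); rewrite (_ : 1 + (p^-1 - 1) = p^-1); last by ring.
rewrite lnV ?posrE// => lq.
have {lq} := lq _; rewrite ltrBrDr addNr invr_gt0 => /(_ p0).
move/(ler_wpM2l (ltW p0)); rewrite mulrBr mulfV ?gt_eqF// mulr1; lra.
Qed.

(** Each term lies between -1 and 0. The bound is crude, but it does not depend on n. *)
Lemma neg_marg_entropy_bounds n : (0 < n)%N ->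
  - #|I|%:R <= neg_marg_entropy n <= 0.
Proof.
move=> n0; set p := @frequency R _ (visits o n).
have term i : - 1 <= p i * ln (marg r p (r i)) <= 0.
  apply: neg_entropy_term_ge.
    by rewrite frequency_ge0 marg_ge// => j; exact: frequency_ge0.
  rewrite -(frequency_visits_sum o n0) (partition_big r predT)//= (bigD1 (r i))//= lerDl.
  by apply: sumr_ge0 => j _; apply: sumr_ge0 => i' _; exact: frequency_ge0.
apply/andP; split; last by apply: sumr_le0 => i _; case/andP: (term i).
rewrite -sumr_const -sumrN; apply: ler_sum => i _; by case/andP: (term i).
Qed.

End visits.

(** * Scales at which the slow entropy ratio hardly grows *)

Section good_scale.
Context {R : realType} (I J : finType) (r : I -> J) (o : nat -> I).
Context (f s : I -> R) (c C H e : R) (q : nat).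
Hypothesis c_gt0 : 0 < c.
Hypothesis f_bounds : forall i, c <= f i <= C.
Hypothesis s_bounds : forall i, c <= s i <= C.
Hypothesis qcC : C <= q%:R * c.

Definition cost (a : I -> R) n : R := \sum_(t < n) a (o t).

Lemma cost_bounds a n : (forall i, c <= a i <= C) ->
  n%:R * c <= cost a n <= n%:R * C.
Proof.
move=> aP; rewrite !mulr_natl -[X in _ *+ X]card_ord -[X in _ <= _ <= _ *+ X]card_ord.
by rewrite -!sumr_const !ler_sum// => t _; case/andP: (aP (o t)).
Qed.

Lemma costS a n : cost a n.+1 = cost a n + a (o n).
Proof. by rewrite /cost big_ord_recr. Qed.

Lemma cost_mono a m n : (forall i, c <= a i <= C) -> (m <= n)%N ->
  cost a m <= cost a n.
Proof.
move=> aP /subnK <-; elim: (n - m)%N => [|d IH] //.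
apply: le_trans IH _; rewrite addSn costS lerDl.
by have /andP[a0 _] := aP (o (d + m)%N); rewrite (le_trans _ a0)// ltW.
Qed.

(** m is the largest length whose slow cost is at most the fast cost at n. Letters cost between c
    and C <= q c, so m <= n q, and maximality gives the last inequality. *)
Lemma next_scale n : (0 < n)%N -> cost s n <= cost f n ->
  exists m, [/\ (n <= m <= n * q)%N, cost s m <= cost f n & cost f n <= cost s m + C].
Proof.
move=> n0 sf; pose P m := cost s m <= cost f n.
have Pn : exists m, P m by exists n.
have Pq m : P m -> (m <= n * q)%N.
  move=> Pm; have /andP[sm _] := cost_bounds m s_bounds.
  have /andP[_ fn] := cost_bounds n f_bounds.
  have := le_trans (le_trans sm Pm) (le_trans fn (ler_wpM2l (ler0n _ n) qcC)).
  by rewrite mulrA -natrM ler_pM2r// ler_nat.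
have [m Pm mP] := ex_maxnP Pn Pq; exists m; split; rewrite ?Pq ?mP//.
have : ~~ P m.+1 by apply/negP => /mP; rewrite ltnn.
rewrite /P -ltNge costS => /ltW/le_trans; apply.
by rewrite lerD2l; case/andP: (s_bounds (o m)).
Qed.

Local Notation E := (@neg_entropy R _ o).
Local Notation E2 := (@neg_marg_entropy R _ _ r o).

Hypothesis H_bound : forall n, (0 < n)%N -> cost s n <= cost f n ->
  (E n - E2 n) / - (n%:R^-1 * cost f n) + E2 n / - (n%:R^-1 * cost s n) <= H.

(** Slow entropy over slow contraction, the quantity whose growth must be controlled. *)
Let g n := n%:R * (- E2 n) / cost s n.

Let cost_gt0 a n : (forall i, c <= a i <= C) -> (0 < n)%N -> 0 < cost a n.
Proof.
move=> aP n0; have /andP[h _] := cost_bounds n aP.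
by apply: lt_le_trans h; rewrite mulr_gt0// ltr0n.
Qed.

Let g_bounds n : (0 < n)%N -> 0 <= g n <= #|I|%:R / c.
Proof.
move=> n0; have /andP[h1 h2] := @neg_marg_entropy_bounds R _ _ r o _ n0.
have s0 := cost_gt0 s_bounds n0; have /andP[sn _] := cost_bounds n s_bounds.
rewrite /g; apply/andP; split.
  by rewrite divr_ge0 ?mulr_ge0 ?oppr_ge0//; exact: ltW.
rewrite ler_pdivrMr// mulrAC ler_pdivlMr// mulrAC [leRHS]mulrC.
apply: ler_pM => //; last by rewrite lerNl.
  by rewrite mulr_ge0//; exact: ltW.
by rewrite oppr_ge0.
Qed.

(** By [word_weight_visits], the left side is minus the logarithm of the weight of the square. *)
Let good n k := - (n%:R * (E n - E2 n) + (n + k)%:R * E2 (n + k)) <= cost f n * (H + e).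

(** The row entropy at m contributes [cost s m * g m], at most [cost f n * (g n + e)]. By [H_bound],
    the conditional entropy at n together with [cost f n * g n] is at most [cost f n * H]. *)
Let good_step n m : (0 < n)%N -> cost s n <= cost f n -> (n <= m)%N ->
  cost s m <= cost f n -> g m <= g n + e -> good n (m - n).
Proof.
move=> n0 sf nm smfn gmn; rewrite /good subnKC//.
have m0 : (0 < m)%N := leq_trans n0 nm.
have f0 := cost_gt0 f_bounds n0; have s0 := cost_gt0 s_bounds n0.
have sm0 := cost_gt0 s_bounds m0.
have nR0 : n%:R != 0 :> R by rewrite pnatr_eq0 -lt0n.
have scaled : cost f n * ((E n - E2 n) / - (n%:R^-1 * cost f n) +
    E2 n / - (n%:R^-1 * cost s n)) = - (n%:R * (E n - E2 n)) + cost f n * g n.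
  by rewrite /g; field; rewrite nR0 !gt_eqF.
have := ler_wpM2l (ltW f0) (H_bound n0 sf); rewrite scaled.
have := ler_wpM2l (ltW f0) gmn; rewrite !mulrDr.
have /andP[gm0 _] := g_bounds m0.
have := ler_wpM2r gm0 smfn.
rewrite (_ : cost s m * g m = - (m%:R * E2 m)); last first.
  by rewrite /g mulrCA mulfV ?gt_eqF// mulr1 mulrN.
lra.
Qed.

Let chain K n : (0 < n)%N -> cost s n <= cost f n ->
  (exists n' k, [/\ (n <= n')%N, (n' + k <= n * q ^ K)%N,
     cost f n' <= cost s (n' + k) + C & good n' k]) \/
  (exists n', [/\ (n <= n' <= n * q ^ K)%N, cost s n' <= cost f n' &
     g n + K%:R * e <= g n']).
Proof.
move=> n0 sf; elim: K => [|K IH].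
  by right; exists n; rewrite expn0 muln1 leqnn mul0r addr0.
have q0 : (0 < q)%N.
  rewrite lt0n; apply/eqP => q0; have /andP[h1 h2] := f_bounds (o 0%N).
  by move: (le_trans h1 (le_trans h2 qcC)); rewrite q0 mul0r leNgt c_gt0.
case: IH => [[n' [k [h1 h2 h3 h4]]]|[n' [/andP[h1 h2] h3 h4]]].
  left; exists n', k; split=> //; apply: leq_trans h2 _.
  by rewrite leq_mul2l leq_pexp2l ?orbT.
have n'0 : (0 < n')%N := leq_trans n0 h1.
have [m [/andP[m1 m2] m3 m4]] := next_scale n'0 h3.
have mK : (m <= n * q ^ K.+1)%N.
  by apply: leq_trans m2 _; rewrite expnSr mulnA leq_mul2r h2 orbT.
have [gm|gm] := leP (g m) (g n' + e).
  left; exists n', (m - n')%N; rewrite subnKC//; split=> //.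
  exact: good_step.
right; exists m; split; first by rewrite (leq_trans h1 m1).
  (* The slow cost at m is at most the fast cost at n, hence at m, so the chain can continue from
     m. *)
  by apply: le_trans m3 _; apply: cost_mono.
by rewrite -addn1 natrD mulrDl mul1r; lra.
Qed.

(* g is bounded, so it cannot grow by e at each of the K steps n |-> m given by
   next_scale; a step at which it does not is a good scale. *)
Lemma good_scale K n : #|I|%:R / c < K%:R * e -> (0 < n)%N ->
  cost s n <= cost f n ->
  exists n' k, [/\ (n <= n')%N, (n' + k <= n * q ^ K)%N,
     cost f n' <= cost s (n' + k) + C &
     - (n'%:R * (E n' - E2 n') + (n' + k)%:R * E2 (n' + k)) <= cost f n' * (H + e)].
Proof.
move=> Ke n0 sf; have [//|[n' [/andP[h1 _] h2 h3]]] := chain K n0 sf.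
have /andP[g0 _] := g_bounds n0; have /andP[_ g1] := g_bounds (leq_trans n0 h1).
lra.
Qed.

End good_scale.

(** * Upper bound *)

Section finite_covers.
Context {R : realType} (s d : R).
Implicit Types A : set (R * R).

Definition finite_cover A (x : R) : Prop := exists U : seq (set (R * R)),
  [/\ A `<=` \big[setU/set0]_(V <- U) V,
      forall i, (diam (nth set0 U i) <= d%:E)%E &
      (\sum_(V <- U) weight s V <= x%:E)%E].

Lemma diam0 : diam (@set0 (R * R)) = -oo%E.
Proof. by rewrite /diam setX0 image_set0 ereal_sup0. Qed.

Lemma weight0 : weight s (@set0 (R * R)) = 0%E.
Proof. by rewrite /weight eqxx. Qed.

Lemma finite_cover_le A B x y : A `<=` B -> x <= y ->
  finite_cover B x -> finite_cover A y.
Proof.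
move=> AB xy [U [BU dU wU]]; exists U; split=> //.
  by apply: subset_trans BU.
by apply: le_trans wU _; rewrite lee_fin.
Qed.

Lemma finite_cover_set A x : (diam A <= d%:E)%E -> (weight s A <= x%:E)%E ->
  finite_cover A x.
Proof.
move=> dA wA; exists [:: A]; split; rewrite ?big_seq1// => -[|i] //=.
by rewrite nth_nil diam0 leNye.
Qed.

Lemma finite_cover0 : finite_cover set0 0.
Proof. by exists [::]; split; rewrite ?big_nil// => i; rewrite nth_nil diam0 leNye. Qed.

Lemma finite_coverU A B x y : finite_cover A x -> finite_cover B y ->
  finite_cover (A `|` B) (x + y).
Proof.
move=> [U [AU dU wU]] [V [BV dV wV]]; exists (U ++ V); split.
- by rewrite big_cat; exact: setUSS.
- by move=> i; rewrite nth_cat; case: ifP.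
- by rewrite big_cat EFinD; exact: leeD.
Qed.

Lemma finite_cover_bigcup (T : finType) (A : T -> set (R * R)) (x : T -> R) :
  (forall t, finite_cover (A t) (x t)) ->
  finite_cover (\bigcup_(t in setT) A t) (\sum_t x t).
Proof.
move=> Ax; suff : finite_cover (\big[setU/set0]_(t <- index_enum T) A t) (\sum_t x t).
  apply: finite_cover_le => // z [t _ Atz].
  by rewrite (bigD1_seq t) ?mem_index_enum ?index_enum_uniq//=; left.
elim: (index_enum T) => [|t r IH]; first by rewrite !big_nil; exact: finite_cover0.
by rewrite !big_cons; exact: finite_coverU.
Qed.

(** The list is padded with empty sets, of diameter -oo and weight 0. *)
Lemma finite_cover_premeasure A x : finite_cover A x ->
  (hausdorff_premeasure s d A <= x%:E)%E.
Proof.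
move=> [U [AU dU wU]]; apply: ereal_inf_le => /=.
exists (\sum_(V <- U) weight s V)%E => //.
exists (nth set0 U); first split => //.
  by move=> z /AU; rewrite (big_nth set0) big_mkord -bigcup_mkord => -[i _ ?]; exists i.
rewrite (nneseries_split 0 (size U)) => [|k _]; last exact: weight_ge0.
rewrite add0n eseries0 ?adde0 => [|i iU _]; first by rewrite [RHS](big_nth set0).
by rewrite nth_default// weight0.
Qed.

End finite_covers.

Lemma exp_small (R : realType) (k t : R) : 0 < k -> 0 < t ->
  exists N, forall n, (N <= n)%N -> expR (- (n%:R * k)) <= t.
Proof.
move=> k0 t0; exists (Num.trunc (- ln t / k)).+1 => n Nn.
rewrite -[leRHS](lnK (x := t)) ?posrE// ler_expR lerNl -ler_pdivrMr//.
by apply: le_trans (ltW (truncnS_gt _)) _; rewrite ler_nat.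
Qed.

(** With u = k / (d + 1), exp(n k) is at least (u n)^(d+1), one power of n more than the left side;
    n >= B absorbs the constants. *)
Lemma poly_le_exp (R : realType) (k : R) (A d : nat) : 0 < k ->
  exists N, forall n, (N <= n)%N -> ((A * n.+1) ^ d)%:R <= expR (n%:R * k).
Proof.
move=> k0; pose u := k / d.+1%:R; have u0 : 0 < u by rewrite divr_gt0// ltr0n.
pose B : R := ((2 * A) ^ d)%:R / u ^+ d.+1.
exists (Num.trunc B).+2 => n Nn.
have n0 : (0 < n)%N by apply: leq_trans Nn.
have nB : B <= n%:R.
  by apply: le_trans (ltW (truncnS_gt _)) _; rewrite ler_nat; apply: leq_trans Nn.
apply: (@le_trans _ _ ((u * n%:R) ^+ d.+1)); last first.
  rewrite (_ : n%:R * k = d.+1%:R * (u * n%:R)); last first.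
    by rewrite /u mulrA (mulrC d.+1%:R) divfK ?pnatr_eq0// mulrC.
  have un0 : 0 <= u * n%:R by rewrite mulr_ge0// ltW.
  rewrite expRM_natl; apply: lerXn2r; rewrite ?nnegrE ?expR_ge0//.
  by have := @expR_ge1Dx R (u * n%:R); lra.
apply: (@le_trans _ _ (((2 * A) ^ d)%:R * n%:R ^+ d)).
  rewrite !natrX -exprMn lerXn2r ?nnegrE ?mulr_ge0// -natrM ler_nat.
  by rewrite -mulnA mulnCA leq_mul2l; apply/orP; right; lia.
rewrite exprMn [n%:R ^+ d.+1]exprS mulrA ler_wpM2r ?exprn_ge0//.
by rewrite -ler_pdivrMl ?exprn_gt0// mulrC.
Qed.

(** * Symbolic coding and D at empirical frequencies *)

Section coding.
Context {R : realType} (G : {fset diagonal_map R}) (L : set (R * R)).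
Hypothesis G_pos : orientation_preserving G.
Hypothesis G_carpet : self_affine_carpet G.
Hypothesis G_attractor : is_attractor G L.
Hypothesis L_normalized : normalized L.
Context (l : nat).

Local Notation F := (n_fold G l).

Let facts := n_fold_facts G_pos G_carpet G_attractor L_normalized.

Definition log_cost (b : bool) (S : F) : R := - ln (ratio (co b (val S))).

Lemma n_fold_attractor m z : L z ->
  exists S z', [/\ S \in n_fold G m, L z' & z = diagonal_eval S z'].
Proof.
elim: m z => [|m IH] z Lz.
  exists diagonal_id, z; split; rewrite ?inE//.
  by case: z {Lz} => u v; rewrite /diagonal_eval /affine_eval /= !mul1r !addr0.
have [_ _ LE] := G_attractor; move: Lz; rewrite {1}LE => -[s sG [z1 /IH[S [z' [SG Lz' ->]]] <-]].
exists (diagonal_comp s S), z'; split=> //; last by rewrite diagonal_compE.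
by apply/n_foldP; exists s, S.
Qed.

(** Keeping every tail x i in L replaces the convergence of the compositions. *)
Definition coded (o : nat -> F) (z : R * R) : Prop := exists x : nat -> R * R,
  [/\ x 0%N = z, forall i, L (x i) &
      forall i, x i = diagonal_eval (val (o i)) (x i.+1)].

Lemma attractor_coded z : L z -> exists o, coded o z.
Proof.
move=> Lz; have [S0 [_ [S0F _ _]]] := n_fold_attractor l Lz.
(* The map S0 supplies a value outside L, which makes the choice total. *)
have /choice[f fP] y : exists p : F * (R * R),
    L y -> L p.2 /\ y = diagonal_eval (val p.1) p.2.
  have [Ly|nLy] := pselect (L y); last by exists ([` S0F]%fset, y).
  by have [S [y' [SF Ly' E]]] := n_fold_attractor l Ly; exists ([` SF]%fset, y').
pose x i := iter i (fun y => (f y).2) z.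
have Lx i : L (x i) by elim: i => [//|i /fP[]].
exists (fun i => (f (x i)).1); exists x; split=> // i.
by have [_] := fP _ (Lx i).
Qed.

Lemma coded_close b m o o' z z' : coded o z -> coded o' z' ->
  (forall t, (t < m)%N -> co b (val (o t)) = co b (val (o' t))) ->
  `|co b z - co b z'| <= expR (- cost o (log_cost b) m).
Proof.
move=> [x [<- Lx xE]] [x' [<- Lx' x'E]] eqo.
have -> : co b (x 0%N) - co b (x' 0%N) =
    expR (- cost o (log_cost b) m) * (co b (x m) - co b (x' m)).
  elim: m eqo => [|m IH] eqo; first by rewrite /cost big_ord0 oppr0 expR0 mul1r.
  rewrite IH => [|t tm]; last by rewrite eqo// ltnW.
  rewrite costS opprD expRD -mulrA; congr (_ * _).
  rewrite xE x'E !co_eval -eqo// /affine_eval /log_cost opprK lnK; last first.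
    by rewrite posrE; have [+ _ _] := facts (valP (o m)).
  by rewrite /ratio; ring.
rewrite normrM ger0_norm ?expR_ge0// ler_piMr ?expR_ge0//.
have := attractor_unit G_attractor L_normalized b (Lx m).
have := attractor_unit G_attractor L_normalized b (Lx' m).
move=> /andP[h1 h2] /andP[h3 h4]; rewrite ler_norml; apply/andP; split; lra.
Qed.

(* The branches agree when the two contractions are equal, hence <= suffices. *)
Lemma D_BA_fast b (p : {ffun F -> R}) : (forall S, 0 <= p S) ->
  log_contraction p (co b) <= log_contraction p (co (~~ b)) ->
  D_BA p = D_branch b p.
Proof.
move=> p0; rewrite D_BA_branch.
have -> : \sum_(S : F) p S * ln (ratio (val S).2 / ratio (val S).1) =
    log_contraction p (co false) - log_contraction p (co true).
  rewrite -sumrB; apply: eq_bigr => S _; rewrite -mulrBr; congr (_ * _).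
  have [r0 _ _] := facts (valP S).
  by rewrite ln_div// posrE; [exact: (r0 false)|exact: (r0 true)].
rewrite subr_ge0; case: b => /= h; first by rewrite h.
case: (boolP (log_contraction p (co true) <= log_contraction p (co false))) => // h'.
have e : log_contraction p (co true) = log_contraction p (co false).
  by apply/le_anti; rewrite h h'.
by rewrite /D_branch /= e; ring.
Qed.

Definition visit_vector (o : nat -> F) n : {ffun F -> R} :=
  [ffun S => frequency (visits o n) S].

Lemma visit_vectorP o n : (0 < n)%N -> probability_vectors (visit_vector o n).
Proof.
move=> n0; split=> [S|]; first by rewrite ffunE frequency_ge0.
under eq_bigr do rewrite ffunE.
exact: frequency_visits_sum.
Qed.

Lemma log_contraction_visits b o n : (0 < n)%N ->
  log_contraction (visit_vector o n) (co b) = - (n%:R^-1 * cost o (log_cost b) n).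
Proof.
move=> n0; rewrite /cost (visits_mean o (log_cost b) n0) mulrA mulVf; last first.
  by rewrite pnatr_eq0 -lt0n.
by rewrite mul1r -sumrN; apply: eq_bigr => S _; rewrite ffunE mulrN opprK.
Qed.

Lemma D_BA_visits b o n : (0 < n)%N ->
  cost o (log_cost (~~ b)) n <= cost o (log_cost b) n ->
  D_BA (visit_vector o n) =
  (@neg_entropy R _ o n - @neg_marg_entropy R _ _ (@fold_proj R G b l) o n) /
    - (n%:R^-1 * cost o (log_cost b) n) +
  @neg_marg_entropy R _ _ (@fold_proj R G b l) o n /
    - (n%:R^-1 * cost o (log_cost (~~ b)) n).
Proof.
move=> n0 sf; have [p0 _] := visit_vectorP o n0.
rewrite (D_BA_fast (b := b))//; last first.
  by rewrite !log_contraction_visits// lerN2 ler_pM2l// invr_gt0 ltr0n.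
rewrite /D_branch !log_contraction_visits//.
have -> : entropy_sum (visit_vector o n) = @neg_entropy R _ o n.
  by apply: eq_bigr => S _; rewrite ffunE.
have -> : marginal_entropy_sum (visit_vector o n) (co (~~ b)) =
    @neg_marg_entropy R _ _ (@fold_proj R G b l) o n.
  rewrite marginal_entropy_sumE; apply: eq_bigr => S _; rewrite ffunE.
  congr (_ * ln _); apply: eq_big => T; first by rewrite fold_projE.
  by rewrite ffunE.
by rewrite mulrBl addrAC.
Qed.

End coding.

Lemma leq_expn2r (m n k : nat) : (m <= n)%N -> (m ^ k <= n ^ k)%N.
Proof. by case: k => [|k] mn; rewrite ?expn0// leq_exp2r. Qed.

(** The factors on the left bound the pairs of count vectors, the values of n and k, and the two
    branches. *)
Lemma scale_count_le (n q m : nat) : (0 < q)%N -> (0 < n)%N ->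
  ((2 * (n * q)).+1 ^ m * ((n * q).+1 * ((n * q).+1 * 2)) <=
   2 * (2 * q * n.+1) ^ (2 + m))%N.
Proof.
move=> q0 n0; have le1 : ((2 * (n * q)).+1 <= 2 * q * n.+1)%N by nia.
have le2 : ((n * q).+1 <= 2 * q * n.+1)%N by nia.
rewrite mulnC [((n * q).+1 * _)%N]mulnC [(_.+1 * 2)%N]mulnC.
rewrite expnD -mulnn [leqRHS]mulnA; apply: leq_mul; last exact: leq_expn2r.
by rewrite -[leqLHS]mulnA; apply: leq_mul => //; exact: leq_mul.
Qed.

Section upper_bound.
Context {R : realType} (G : {fset diagonal_map R}) (L : set (R * R)).
Hypothesis G_pos : orientation_preserving G.
Hypothesis G_carpet : self_affine_carpet G.
Hypothesis G_attractor : is_attractor G L.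
Hypothesis L_normalized : normalized L.
Context (l : nat).
Hypothesis l_gt0 : (0 < l)%N.

Local Notation F := (n_fold G l).
Local Notation J b := ([fset co (~~ b) S | S in F]%fset).
Local Notation a := (@log_cost R G l).

Lemma euclidean_dist_le (z w : R * R) :
  euclidean_dist z w <= `|z.1 - w.1| + `|z.2 - w.2|.
Proof.
rewrite -[leRHS]ger0_norm ?addr_ge0// -sqrtr_sqr ler_sqrt ?sqr_ge0//.
rewrite -(real_normK (num_real (z.1 - w.1))) -(real_normK (num_real (z.2 - w.2))).
by rewrite sqrrD lerD2r lerDl mulrn_wge0// mulr_ge0.
Qed.

Lemma weight_diam_le (s d : R) (U : set (R * R)) : 0 <= s ->
  U !=set0 -> (forall z w, U z -> U w -> euclidean_dist z w <= d) ->
  (diam U <= d%:E)%E /\ (weight s U <= (d `^ s)%:E)%E.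
Proof.
move=> s0 [u Uu] Ud; have dU : (diam U <= d%:E)%E.
  by apply: ge_ereal_sup => _ [[z w] [/= Uz Uw] <-]; rewrite lee_fin Ud.
split=> //; rewrite /weight ifF; last by apply/negbTE/set0P; exists u.
have := diam_ge0 Uu; move: dU; case: (diam U) => [x| |] //=.
rewrite !lee_fin => xd x0; apply: ge0_ler_powR => //; rewrite nnegrE//.
exact: le_trans xd.
Qed.

Lemma cost_ffun b n (o : nat -> F) (w : {ffun 'I_n -> F}) :
  (forall t : 'I_n, o t = w t) -> cost o (a b) n = \sum_(t < n) a b (w t).
Proof. by move=> ow; apply: eq_bigr => t _; rewrite ow. Qed.

(** An approximate square: n letters fix the fast side and n + k rows the slow one. The last two
    conditions come from [good_scale]: the slow side is at most comparable to the fast one, and the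
    weight is large. *)
Definition scale_piece (b : bool) (C u : R) n k
    (w : {ffun 'I_n -> F}) (v : {ffun 'I_k -> J b}) : set (R * R) :=
  [set z | exists o, [/\ coded L o z, forall t : 'I_n, o t = w t,
    forall t : 'I_k, fold_proj b (o (n + t)%N) = v t,
    cost o (a b) n <= cost o (a (~~ b)) (n + k) + C &
    expR (- (cost o (a b) n * u)) <= word_weight (@fold_proj R G b l) w v]].

Lemma scale_piece_dist b C u n k w v z z' : 0 <= C ->
  @scale_piece b C u n k w v z -> @scale_piece b C u n k w v z' ->
  euclidean_dist z z' <= (1 + expR C) * expR (- \sum_(t < n) a b (w t)).
Proof.
move=> C0 [ o [oz ow ov oC _]] [ o' [oz' ow' ov' _ _]].
have fast : `|co b z - co b z'| <= expR (- \sum_(t < n) a b (w t)).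
  rewrite -(cost_ffun _ ow).
  apply: (coded_close G_pos G_carpet G_attractor L_normalized oz oz') => t tn.
  by rewrite (ow (Ordinal tn)) (ow' (Ordinal tn)).
have slow : `|co (~~ b) z - co (~~ b) z'| <=
    expR C * expR (- \sum_(t < n) a b (w t)).
  rewrite -(cost_ffun _ ow) -expRD.
  apply: (@le_trans _ _ (expR (- cost o (a (~~ b)) (n + k)))); last first.
    by rewrite ler_expR; lra.
  apply: (coded_close G_pos G_carpet G_attractor L_normalized oz oz') => t tnk.
  have [tn|nt] := ltnP t n.
    by rewrite (ow (Ordinal tn)) (ow' (Ordinal tn)).
  have tk : (t - n < k)%N by rewrite ltn_subLR.
  have := ov' (Ordinal tk); rewrite -(ov (Ordinal tk)) /= subnKC// => E.
  by apply/eqP; rewrite -fold_projE E.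
apply: le_trans (euclidean_dist_le z z') _; rewrite mulrDl mul1r.
move: fast slow; move: (expR (- \sum_(t < n) a b (w t))) => E.
by case: (b) => /= fast slow; [|rewrite addrC]; exact: lerD.
Qed.

(** Since s = H + 2 e, a square of size exp(-A) costs exp(-A e) exp(-A (H + e)) up to a constant.
    The second factor is at most its word weight, and these weights have a polynomial sum; the first
    factor decays exponentially in n0. *)
Lemma hausdorff_measure_eq0 (H s : R) : 0 <= s -> H < s ->
  (forall p : {ffun F -> R}, probability_vectors p -> D_BA p <= H) ->
  hausdorff_measure s L = 0%E.
Proof.
move=> s0 Hs DH.
have [c0 c00 c0P] := ln_ratio_le G_carpet G_pos.
pose c := l%:R * c0; have c_gt0 : 0 < c by rewrite mulr_gt0// ltr0n.
have ca b S : c <= a b S by apply: c0P; exact: valP.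
pose C := \sum_(x : bool * F) a x.1 x.2.
have aC b S : a b S <= C.
  rewrite /C (bigD1 (b, S))//= lerDl sumr_ge0// => x _.
  exact: le_trans (ltW c_gt0) (ca _ _).
have bounds b S : c <= a b S <= C by rewrite ca aC.
have C0 : 0 <= C by apply: sumr_ge0 => x _; exact: le_trans (ltW c_gt0) (ca _ _).
pose e := (s - H) / 2; have e0 : 0 < e by rewrite /e; lra.
pose q := (Num.trunc (C / c)).+1.
have qc : C <= q%:R * c by rewrite -ler_pdivrMr// ltW// truncnS_gt.
pose K := (Num.trunc (#|{: F}|%:R / c / e)).+1.
have Ke : #|{: F}|%:R / c < K%:R * e by rewrite -ltr_pdivrMr// truncnS_gt.
pose B := 1 + expR C; have B0 : 0 < B by rewrite addr_gt0// expR_gt0.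
have premeasure_le d t : 0 < d -> 0 < t -> (hausdorff_premeasure s d L <= t%:E)%E.
  move=> d0 t0.
  (* One power each for the choices of n and k, and the cardinality of F twice: for the letter
     counts and, through [cardJ], for the row counts. *)
  pose D := (2 + (#|{: F}| + #|{: F}|))%N.
  (* Half of the decay rate e c pays for the polynomial, the other half makes the sum less than
     t. *)
  have ec2 : 0 < e * c / 2 by rewrite divr_gt0// mulr_gt0.
  have [N1 N1P] := poly_le_exp (2 * q ^ K) D ec2.
  have [|N2 N2P] := exp_small (t := t / (2 * B `^ s)) ec2.
    by rewrite divr_gt0// mulr_gt0// powR_gt0.
  have [|N3 N3P] := exp_small (t := d / B) c_gt0; first by rewrite divr_gt0.
  pose n0 := (N1 + N2 + N3).+1.
  have {}N1P := N1P n0 (leqW (leq_trans (leq_addr _ _) (leq_addr _ _))).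
  have {}N2P := N2P n0 (leqW (leq_trans (leq_addl _ _) (leq_addr _ _))).
  have {}N3P := N3P n0 (leqW (leq_addl _ _)).
  pose M := (n0 * q ^ K)%N.
  pose K0 := B `^ s * expR (- (n0%:R * (e * c))).
  have K00 : 0 <= K0 by rewrite mulr_ge0 ?powR_ge0 ?expR_ge0.
  apply: finite_cover_premeasure.
  (* Pieces with n < n0 are made empty, so that n can range over an ordinal type. *)
  pose Q (b : bool) (n k : 'I_M.+1) (w : {ffun 'I_n -> F}) (v : {ffun 'I_k -> J b}) :=
    [set z | (n0 <= n)%N /\ scale_piece C (H + e) w v z].
  have Qcover b n k w v : finite_cover s d (@Q b n k w v)
      (K0 * word_weight (@fold_proj R G b l) w v).
    have [->|/set0P[z0 Qz0]] := eqVneq (@Q b n k w v) set0.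
      apply: finite_cover_set; first by rewrite diam0 leNye.
      rewrite weight0 lee_fin mulr_ge0//.
      rewrite /word_weight mulr_ge0//; apply: prodr_ge0 => i _.
        exact: letter_weight_ge0.
      exact: frequency_ge0.
    have [nn0 [ o [_ ow ov _ oweight]]] := Qz0.
    pose A := \sum_(t < n) a b (w t).
    have An : n0%:R * c <= A.
      have := cost_bounds o n (bounds b); rewrite (cost_ffun _ ow) => /andP[+ _].
      by apply: le_trans; rewrite ler_wpM2r ?(ltW c_gt0)// ler_nat.
    have [dQ wQ] : (diam (@Q b n k w v) <= (B * expR (- A))%:E)%E /\
        (weight s (@Q b n k w v) <= ((B * expR (- A)) `^ s)%:E)%E.
      apply: weight_diam_le => //; first by exists z0.
      by move=> z z' [_ Qz] [_ Qz']; exact: scale_piece_dist Qz Qz'.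
    have eA : expR (- A) <= expR (- (n0%:R * c)) by rewrite ler_expR lerN2.
    apply: finite_cover_set.
      apply: le_trans dQ _; rewrite lee_fin mulrC -ler_pdivlMr//.
      exact: le_trans N3P.
    apply: le_trans wQ _; rewrite lee_fin powRM ?expR_ge0 ?(ltW B0)//.
    rewrite /K0 -mulrA ler_wpM2l ?powR_ge0//.
    have -> : expR (- A) `^ s = expR (- (A * e)) * expR (- (A * (H + e))).
      by rewrite -expRM -expRD; congr expR; rewrite /e; field.
    rewrite (cost_ffun _ ow) -/A in oweight.
    apply: ler_pM; rewrite ?expR_ge0// ler_expR lerN2.
    by have := ler_wpM2r (ltW e0) An; rewrite -mulrA [c * e]mulrC.
  have Lcover : L `<=` \bigcup_(b in [set: bool]) \bigcup_(n in [set: 'I_M.+1])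
      \bigcup_(k in [set: 'I_M.+1]) \bigcup_(w in setT) \bigcup_(v in setT) @Q b n k w v.
    move=> z Lz.
    have [ o oz] := attractor_coded G_attractor l Lz.
    (* The branch depends on the point: its fast coordinate is the one with the larger cost at
       n0. *)
    have [b sf] : exists b, cost o (a (~~ b)) n0 <= cost o (a b) n0.
      have [h|h] := leP (cost o (a false) n0) (cost o (a true) n0).
        by exists true.
      by exists false; exact: ltW.
    have Hb n : (0 < n)%N -> cost o (a (~~ b)) n <= cost o (a b) n ->
      (@neg_entropy R _ o n - @neg_marg_entropy R _ _ (@fold_proj R G b l) o n) /
        - (n%:R^-1 * cost o (a b) n) +
      @neg_marg_entropy R _ _ (@fold_proj R G b l) o n /
        - (n%:R^-1 * cost o (a (~~ b)) n) <= H.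
      move=> n_gt0 h.
      rewrite -(D_BA_visits G_pos G_carpet G_attractor L_normalized n_gt0 h).
      by apply: DH; exact: visit_vectorP.
    have [n [k [n0n nkM fC good]]] := good_scale c_gt0 (bounds b) (bounds (~~ b)) qc Hb Ke
      (ltn0Sn _) sf.
    have nM : (n < M.+1)%N by rewrite ltnS (leq_trans _ nkM)// leq_addr.
    have kM : (k < M.+1)%N by rewrite ltnS (leq_trans _ nkM)// leq_addl.
    exists b => //; exists (Ordinal nM) => //; exists (Ordinal kM) => //.
    exists [ffun t : 'I_n => o t] => //.
    exists [ffun t : 'I_k => fold_proj b (o (n + t)%N)] => //.
    split=> //; exists o; split=> //; try by move=> i; rewrite ffunE.
    suff : expR (- (cost o (a b) n * (H + e))) <= word_weight (@fold_proj R G b l)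
        [ffun t : 'I_n => o t] [ffun t : 'I_k => fold_proj b (o (n + t)%N)] by [].
    rewrite word_weight_visits; last exact: leq_trans n0n.
    by rewrite ler_expR lerNl.
  apply: (finite_cover_le Lcover (x := \sum_b \sum_n \sum_k \sum_w \sum_v
      K0 * word_weight (@fold_proj R G b l) w v)); last first.
    do 5 (apply: finite_cover_bigcup => ?); exact: Qcover.
  have cardJ b : (#|{: J b}| <= #|{: F}|)%N.
    by rewrite -!cardfE; exact: leq_imfset_card.
  apply: (@le_trans _ _ (\sum_(b : bool) \sum_(n < M.+1) \sum_(k < M.+1)
      K0 * ((2 * M).+1 ^ (#|{: F}| + #|{: F}|))%:R)).
    apply: ler_sum => b _; apply: ler_sum => n _; apply: ler_sum => k _.
    under eq_bigr do rewrite -mulr_sumr.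
    rewrite -mulr_sumr ler_wpM2l//; apply: (le_trans (sum_word_weight (@fold_proj R G b l) n k)).
    rewrite ler_nat expnD leq_mul//.
      by apply: leq_expn2r; rewrite ltnS mul2n -addnn (leq_trans (ltnSE (ltn_ord n)))// leq_addr.
    apply: (@leq_trans ((2 * M).+1 ^ #|{: J b}|)).
      by apply: leq_expn2r; rewrite ltnS mul2n -addnn leq_add// -ltnS.
    by rewrite leq_pexp2l.
  rewrite !sumr_const card_bool !card_ord -!mulrnA.
  rewrite -[leLHS]mulr_natr -mulrA -natrM.
  apply: (@le_trans _ _ (K0 * (2 * expR (n0%:R * (e * c / 2))))).
    rewrite ler_wpM2l//; apply: le_trans (ler_wpM2l _ N1P) => //.
    by rewrite -natrM ler_nat; apply: scale_count_le => //; rewrite expn_gt0.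
  have {}N2P : expR (- (n0%:R * (e * c / 2))) * (2 * B `^ s) <= t.
    by rewrite -ler_pdivlMr// mulr_gt0// powR_gt0.
  apply: le_trans N2P; rewrite /K0 le_eqVlt; apply/orP; left; apply/eqP.
  rewrite [RHS]mulrC -[RHS]mulrA -[LHS]mulrA.
  have -> : expR (- (n0%:R * (e * c))) =
      expR (- (n0%:R * (e * c / 2))) * expR (- (n0%:R * (e * c / 2))).
    by rewrite -expRD; congr expR; field.
  rewrite [expR (_ * (_ / 2))](_ : _ = (expR (- (n0%:R * (e * c / 2))))^-1);
    last by rewrite expRN invrK.
  by field; rewrite gt_eqF// expR_gt0.
apply/le_anti/andP; split.
  apply: ge_ereal_sup => _ [d /= d0 <-].
  apply/lee_addgt0Pr => t t0; rewrite add0e; exact: premeasure_le.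
apply: le_trans (ereal_sup_ubound _); last by exists 1; [exact: ltr01|reflexivity].
apply: le_ereal_inf_tmp => _ [U _ <-]; apply: nneseries_ge0 => i _ _; exact: weight_ge0.
Qed.

End upper_bound.

(** * The maximum defining H_BA is attained *)

Section continuity.
Context {R : realType}.

(** For x > 0 this is ln y <= y - 1 at y = 1 / sqrt x. *)
Lemma xlogx_cvg0 (x : R) : 0 <= x <= 1 -> `|xlogx x| <= 2 * Num.sqrt x.
Proof.
move=> /andP[x0 x1]; move: x0; rewrite le_eqVlt => /orP[/eqP <-|x0].
  by rewrite /xlogx mul0r normr0 mulr_ge0// sqrtr_ge0.
have s0 : 0 < Num.sqrt x by rewrite sqrtr_gt0.
have xE : x = Num.sqrt x * Num.sqrt x by rewrite -expr2 sqr_sqrtr// ltW.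
rewrite /xlogx normrM (gtr0_norm x0) ler0_norm ?ln_le0//.
have lnE : ln x = 2 * ln (Num.sqrt x) by rewrite {1}xE lnM ?posrE//; ring.
have := @le_ln1Dx R ((Num.sqrt x)^-1 - 1).
rewrite (_ : 1 + _ = (Num.sqrt x)^-1); last by ring.
rewrite ltrBrDr addNr invr_gt0 lnV ?posrE// => /(_ s0) h.
rewrite lnE [X in X * _]xE -mulrA.
have -> : Num.sqrt x * - (2 * ln (Num.sqrt x)) = 2 * (Num.sqrt x * - ln (Num.sqrt x)) by ring.
rewrite mulrCA ler_pM2l// -[leRHS]mulr1 ler_pM2l//.
have := ler_wpM2l (ltW s0) h; rewrite mulrBr mulfV ?gt_eqF// mulr1; lra.
Qed.

(** Negative arguments occur because D is extended to all vectors; [ln] vanishes there, so only 0 is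
    delicate. *)
Lemma xlogx_continuous : continuous (@xlogx R).
Proof.
move=> x; have [x0|x0|->] := ltgtP x 0.
- rewrite /continuous_at /xlogx; apply/cvgrPdist_le => /= e e0; near=> y.
  have y0 : y < 0 by near: y; exact: lt_nbhsl.
  by rewrite !ln0 ?(ltW x0) ?(ltW y0)// !mulr0 subrr normr0 ltW.
- exact: (cvgM (@cvg_id _ _) (continuous_ln x0)).
- rewrite /xlogx /continuous_at mul0r; apply/cvgrPdist_le => /= e e0.
  have d0 : 0 < Num.min 1 ((e / 2) ^+ 2).
    by rewrite lt_min ltr01 exprn_gt0// divr_gt0.
  near=> y; rewrite sub0r normrN.
  have : y < Num.min 1 ((e / 2) ^+ 2) by near: y; exact: lt_nbhsl.
  rewrite lt_min => /andP[y1 ye].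
  have [y0|y0] := leP y 0; first by rewrite ln0// mulr0 normr0 ltW.
  apply: le_trans (xlogx_cvg0 _) _; first by rewrite !ltW.
  rewrite -ler_pdivlMl// mulrC -(ger0_norm (_ : 0 <= e / 2)) -?sqrtr_sqr; last by lra.
  by rewrite ler_wsqrtr// ltW.
Unshelve. all: by end_near.
Qed.

Lemma sum_continuous (T : topologicalType) (I : Type) (r : seq I) (P : pred I)
    (f : I -> T -> R) :
  (forall i, continuous (f i)) -> continuous (fun v => \sum_(i <- r | P i) f i v).
Proof.
move=> fc v; apply: cvg_big => //; first exact: add_continuous.
by move=> i _; exact: fc.
Qed.

Lemma maxr_continuous (T : topologicalType) (f g : T -> R) :
  continuous f -> continuous g -> continuous (fun v => Num.max (f v) (g v)).
Proof. by move=> fc gc v; apply: (@continuous_max _ _ f g); [exact: fc|exact: gc]. Qed.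

Context (T : topologicalType).
Implicit Types f g : T -> R.

Lemma continuous_mulr f g :
  continuous f -> continuous g -> continuous (fun v => f v * g v).
Proof. by move=> fc gc v; exact: (cvgM (fc v) (gc v)). Qed.

Lemma continuous_subr f g :
  continuous f -> continuous g -> continuous (fun v => f v - g v).
Proof. by move=> fc gc v; exact: (cvgB (fc v) (gc v)). Qed.

Lemma continuous_oppr f : continuous f -> continuous (fun v => - f v).
Proof. by move=> fc v; exact: (cvgN (fc v)). Qed.

Lemma continuous_invr f : (forall v, f v != 0) ->
  continuous f -> continuous (fun v => (f v)^-1).
Proof. by move=> f0 fc v; exact: (cvgV (f0 v) (fc v)). Qed.

End continuity.

Section attained.
Context {R : realType} (F : {fset diagonal_map R}).
Hypothesis F0 : F != fset0.
Hypothesis F_ratio : forall S b, S \in F -> 0 < ratio (co b S) < 1.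

Let m := #|{: F}|.
Let vec (v : 'rV[R]_m) : {ffun F -> R} := [ffun S => v 0 (enum_rank S)].

Let vec_continuous S : continuous (fun v => vec v S).
Proof.
have -> : (fun v => vec v S) = (fun v => v 0 (enum_rank S)).
  by apply/funext => v; rewrite ffunE.
exact: coord_continuous.
Qed.

Let cmin := \big[Order.min/1]_(x : bool * F) (- ln (ratio (co x.1 (val x.2)))).

Let cmin_gt0 : 0 < cmin.
Proof.
apply: lt_bigmin => // -[b S] _ /=; rewrite oppr_gt0 ln_lt0//.
by apply: F_ratio; exact: valP.
Qed.

Let cmin_le b (S : F) : cmin <= - ln (ratio (co b (val S))).
Proof. by rewrite /cmin (bigD1 (b, S))//= ge_min lexx. Qed.

(** Truncation at [cmin] keeps the denominators positive off the simplex and changes nothing on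
    it. *)
Let den b v : R := Num.max cmin (- log_contraction (vec v) (co b)).

Let den_gt0 b v : 0 < den b v. Proof. by rewrite lt_max cmin_gt0. Qed.

Let den_continuous b : continuous (den b).
Proof.
apply: maxr_continuous; first exact: cst_continuous.
apply: continuous_oppr; apply: sum_continuous => S.
by apply: continuous_mulr; [exact: vec_continuous|exact: cst_continuous].
Qed.

Let denE b v : probability_vectors (vec v) -> den b v = - log_contraction (vec v) (co b).
Proof.
move=> [p0 p1]; apply/max_idPr; rewrite -[leLHS]mul1r -p1 mulr_suml -sumrN.
apply: ler_sum => S _; rewrite -mulrN ler_wpM2l//.
Qed.

(* A common expression for both branches of D_BA, visibly continuous. *)
Let D v : R :=
  - entropy_sum (vec v) / Num.max (den true v) (den false v)
  - marginal_entropy_sum (vec v) (co false) *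
    ((den false v)^-1 - (Num.max (den true v) (den false v))^-1)
  - marginal_entropy_sum (vec v) (co true) *
    ((den true v)^-1 - (Num.max (den true v) (den false v))^-1).

Let D_continuous : continuous D.
Proof.
have mc : continuous (fun v => Num.max (den true v) (den false v)).
  by apply: maxr_continuous; exact: den_continuous.
have m0 v : Num.max (den true v) (den false v) != 0 by rewrite gt_eqF// lt_max den_gt0.
have inv b : continuous (fun v => (den b v)^-1).
  by apply: continuous_invr; [move=> v; rewrite gt_eqF|exact: den_continuous].
have marg_c pr : continuous (fun v => marginal_entropy_sum (vec v) pr).
  apply: sum_continuous => f v.
  apply: (continuous_comp (f := fun v => marginal (vec v) pr f)); last exact: xlogx_continuous.
  by apply: sum_continuous => S; exact: vec_continuous.
have ent_c : continuous (fun v => entropy_sum (vec v)).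
  apply: sum_continuous => S v.
  apply: (continuous_comp (f := fun v => vec v S)); first exact: vec_continuous.
  exact: xlogx_continuous.
have minv : continuous (fun v => (Num.max (den true v) (den false v))^-1).
  exact: continuous_invr.
apply: continuous_subr; first apply: continuous_subr.
- by apply: continuous_mulr; [apply: continuous_oppr; exact: ent_c|exact: minv].
- by apply: continuous_mulr; [exact: marg_c|apply: continuous_subr; [exact: inv|exact: minv]].
- by apply: continuous_mulr; [exact: marg_c|apply: continuous_subr; [exact: inv|exact: minv]].
Qed.

(** The larger denominator belongs to the fast coordinate, whose own marginal term therefore has a
    zero factor; what remains is the branch. *)
Let DE v : probability_vectors (vec v) -> D v = D_BA (vec v).
Proof.
move=> pv; rewrite /D !denE// D_BA_branch.
have -> : \sum_(S : F) vec v S * ln (ratio (val S).2 / ratio (val S).1) =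
    log_contraction (vec v) (co false) - log_contraction (vec v) (co true).
  rewrite -sumrB; apply: eq_bigr => S _; rewrite -mulrBr; congr (_ * _).
  have /andP[r1 _] := F_ratio true (valP S); have /andP[r2 _] := F_ratio false (valP S).
  by rewrite ln_div.
have n1 : log_contraction (vec v) (co true) != 0.
  by rewrite -oppr_eq0 -denE// gt_eqF.
have n2 : log_contraction (vec v) (co false) != 0.
  by rewrite -oppr_eq0 -denE// gt_eqF.
rewrite subr_ge0; case: leP => l12.
  rewrite (elimT max_idPl) ?lerN2// /D_branch [~~ _]/=.
  by field; apply/andP.
rewrite (elimT max_idPr) ?lerN2 ?(ltW l12)// /D_branch [~~ _]/=.
by field; apply/andP.
Qed.

Lemma H_BA_attained : (exists2 p : {ffun F -> R}, probability_vectors p & D_BA p = H_BA F) /\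
  forall p : {ffun F -> R}, probability_vectors p -> D_BA p <= H_BA F.
Proof.
pose A : set 'rV[R]_m := [set v : 'rV[R]_m | forall i, `[0, 1]%classic (v ord0 i)] `&`
  (fun v => \sum_S vec v S) @^-1` [set 1].
have AP v : A v <-> probability_vectors (vec v).
  split=> [[v01 /= v1]|[v0 v1]].
    by split=> // S; rewrite ffunE; have := v01 (enum_rank S); rewrite /= in_itv => /andP[].
  split=> // i; rewrite /= in_itv /=.
  have viE : v 0 i = vec v (enum_val i) by rewrite ffunE enum_valK.
  by rewrite viE v0 /= -v1 (bigD1 (enum_val i))//= lerDl sumr_ge0.
have ff (p : {ffun F -> R}) : exists v, vec v = p.
  exists (\row_i p (enum_val i)); apply/ffunP => S.
  by rewrite ffunE mxE enum_rankK.
have cA : compact A.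
  apply: compact_closedI; first apply: (@rV_compact R m (fun=> `[0, 1]%classic)) => i.
    exact: segment_compact.
  apply: closed_comp; last exact: closed_eq.
  by move=> v _; apply: sum_continuous => S; exact: vec_continuous.
have A0 : A !=set0.
  have [S0 S0F] := fset0Pn _ F0.
  have [v vE] := ff [ffun S => (S == [` S0F]%fset)%:R].
  exists v; apply/AP; rewrite vE; split=> [S|]; first by rewrite ffunE.
  rewrite (bigD1 [` S0F]%fset)//= ffunE eqxx big1 ?addr0// => S /negbTE SS0.
  by rewrite ffunE SS0.
have [|v] := @EVT_max_rV R m D A A0 cA; first exact: continuous_subspaceT.
rewrite inE => /AP Av vmax.
have vub (p : {ffun F -> R}) : probability_vectors p -> D_BA p <= D_BA (vec v).
  by have [u <-] := ff p => pu; rewrite -!DE// vmax// inE; exact/AP.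
have HE : H_BA F = D_BA (vec v).
  by apply: maximumE => [|_ [p pp <-]]; [exists (vec v)|exact: vub].
by split=> [|p pp]; [exists (vec v)|rewrite HE vub].
Qed.

End attained.

(** * The limit *)

Section branch_sign.
Context {R : realType} (F : {fset diagonal_map R}).
Hypothesis F_ratio : forall S b, S \in F -> 0 < ratio (co b S) < 1.

(** Conditional and marginal entropies are nonnegative. This makes exponents above [H_BA] admissible
    in [hausdorff_dim], which only ranges over s >= 0. *)
Lemma D_BA_ge0 (p : {ffun F -> R}) : probability_vectors p -> 0 <= D_BA p.
Proof.
move=> [p0 p1]; rewrite D_BA_branch; move: (0 <= \sum_(S : F) _) => b.
have l_le0 b' : log_contraction p (co b') <= 0.
  apply: sumr_le0 => S _; rewrite mulr_ge0_le0// ltW// ln_lt0//.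
  by apply: F_ratio; exact: valP.
have p_le S : p S <= marginal p (co (~~ b)) (co (~~ b) (val S)).
  by rewrite /marginal (bigD1 S)//= lerDl sumr_ge0.
have q_le1 S : marginal p (co (~~ b)) (co (~~ b) (val S)) <= 1.
  by rewrite -p1 [leRHS](bigID [pred T | co (~~ b) (val T) == co (~~ b) (val S)])/= lerDl sumr_ge0.
rewrite (_ : D_branch b p = (entropy_sum p - marginal_entropy_sum p (co (~~ b))) /
    log_contraction p (co b) + marginal_entropy_sum p (co (~~ b)) /
    log_contraction p (co (~~ b))); last by rewrite /D_branch; ring.
apply: addr_ge0.
  rewrite mulr_le0 ?invr_le0// subr_le0 marginal_entropy_sumE.
  apply: ler_sum => S _; have := p0 S; rewrite le_eqVlt => /orP[/eqP <-|pS].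
    by rewrite /xlogx !mul0r.
  by rewrite ler_pM2l// ler_ln// posrE// (lt_le_trans pS).
rewrite mulr_le0 ?invr_le0// marginal_entropy_sumE.
by apply: sumr_le0 => S _; rewrite mulr_ge0_le0// ln_le0.
Qed.

End branch_sign.

Lemma class_number_le (R : realType) (G : {fset diagonal_map R}) n :
  (class_number G n <= (#|{: G}|.+1 * n.+1) ^ #|{: G}|.+1)%N.
Proof.
rewrite /class_number expnS mulnC; apply: leq_mul; first by nia.
by apply: leq_expn2r; nia.
Qed.

Section limit.
Context {R : realType} (G : {fset diagonal_map R}) (L : set (R * R)).
Hypothesis G_pos : orientation_preserving G.
Hypothesis G_carpet : self_affine_carpet G.
Hypothesis G_attractor : is_attractor G L.
Hypothesis L_normalized : normalized L.

Lemma n_fold_ratio n S b : (0 < n)%N -> S \in n_fold G n -> 0 < ratio (co b S) < 1.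
Proof.
move=> n0 Sn; have [r0 _ _] := n_fold_facts G_pos G_carpet G_attractor L_normalized Sn.
have [c c0 cP] := ln_ratio_le G_carpet G_pos.
rewrite r0 -ltr_ln ?posrE ?ltr01// ln1 -oppr_gt0.
by apply: lt_le_trans (cP n b S Sn); rewrite mulr_gt0// ltr0n.
Qed.

Lemma H_BA_n_fold n : (0 < n)%N ->
  (exists2 p : {ffun n_fold G n -> R}, probability_vectors p & D_BA p = H_BA (n_fold G n)) /\
  forall p : {ffun n_fold G n -> R}, probability_vectors p -> D_BA p <= H_BA (n_fold G n).
Proof.
move=> n0; apply: H_BA_attained => [|S b]; last exact: n_fold_ratio.
have [[z Lz] _ _] := G_attractor.
have [S [_ [Sn _ _]]] := n_fold_attractor G_attractor n Lz.
by apply/fset0Pn; exists S.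
Qed.

Lemma coordinate_ordering_n_fold n S : coordinate_ordering G ->
  S \in n_fold G n -> ratio (co true S) <= ratio (co false S).
Proof.
move=> ord; elim: n S => [|n IH] S; first by rewrite inE => /eqP ->.
move=> /n_foldP[s [T [sG Tn ->]]]; rewrite !co_comp.
have [r0 _ _] := n_fold_facts G_pos G_carpet G_attractor L_normalized Tn.
have /andP[s1 _] := ratio_G G_pos G_carpet true sG.
have /andP[s2 _] := ratio_G G_pos G_carpet false sG.
apply: ler_pM; [exact: ltW|apply: ltW; exact: r0| |exact: IH].
by have := ord s sG; rewrite !gtr0_norm.
Qed.

(** The constants m and c depend on neither n nor t. Two weak separation conditions give gaps with
    either coordinate as the fast one; the other hypothesis gives them for the first only, but
    coordinate ordering makes this the branch of every p. *)
Lemma H_BA_le :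
  (weak_separation (projected1 G) /\ weak_separation (projected2 G)) \/
  [/\ coordinate_ordering G, rectangular_osc G & weak_separation (projected2 G)] ->
  exists m c : R, 0 < c /\ forall n t, (0 < n)%N -> 0 <= t ->
    hausdorff_measure t L = 0%E ->
    H_BA (n_fold G n) <= t + (2 * ln (class_number G n)%:R + m) / (n%:R * c).
Proof.
move=> cases; have [c c0 cP] := ln_ratio_le G_carpet G_pos.
have branch (b : bool) : (exists2 e : R, 0 < e & fold_gap G b e) ->
    exists m : nat, forall n t (p : {ffun n_fold G n -> R}), (0 < n)%N -> 0 <= t ->
      hausdorff_measure t L = 0%E -> probability_vectors p ->
      D_branch b p <= t + (2 * ln (class_number G n)%:R + (2 * ln m%:R + ln 2)) / (n%:R * c).
  move=> [e e0 gap]; pose m := (Num.trunc (1 / e)).+1.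
  have me : 1 <= m%:R * e by rewrite -ler_pdivrMr// ltW// truncnS_gt.
  exists m => n t p n0 t0 Ht pp; rewrite addrA.
  by apply: (D_branch_le G_pos G_carpet G_attractor L_normalized e0 gap) => // b' S; exact: cP.
have err_le n (lT u v : R) : (0 < n)%N -> u <= v ->
    (lT + u) / (n%:R * c) <= (lT + v) / (n%:R * c).
  by move=> n0 uv; rewrite ler_pM2r ?lerD2l// invr_gt0 mulr_gt0// ltr0n.
case: cases => [[w1 w2]|[ord osc w2]].
  have [m1 m1P] := branch true (fold_gap_weak_separation G_pos G_carpet
    G_attractor L_normalized (b := true) w1 w2).
  have [m2 m2P] := branch false (fold_gap_weak_separation G_pos G_carpet
    G_attractor L_normalized (b := false) w2 w1).
  exists (Num.max (2 * ln m1%:R + ln 2) (2 * ln m2%:R + ln 2)), c; split=> // n t n0 t0 Ht.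
  have [[p pp <-] _] := H_BA_n_fold n0; rewrite D_BA_branch.
  case: (0 <= \sum_(S : n_fold G n) _); [apply: le_trans (m1P _ _ _ n0 t0 Ht pp) _|
    apply: le_trans (m2P _ _ _ n0 t0 Ht pp) _];
    by rewrite lerD2l err_le// le_max lexx ?orbT.
have [m mP] := branch true (fold_gap_rectangular_osc G_pos G_carpet
  G_attractor L_normalized osc w2).
exists (2 * ln m%:R + ln 2), c; split=> // n t n0 t0 Ht.
have [[p pp <-] _] := H_BA_n_fold n0; have [p0 _] := pp.
rewrite (D_BA_fast G_pos G_carpet G_attractor L_normalized (b := true))//; first exact: mP.
apply: ler_sum => S _; rewrite ler_wpM2l// ler_ln ?posrE.
- by apply: (coordinate_ordering_n_fold ord (valP S)).
- by case/andP: (n_fold_ratio true n0 (valP S)).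
- by case/andP: (n_fold_ratio false n0 (valP S)).
Qed.

Lemma class_number_error (m c e : R) : 0 < c -> 0 < e ->
  exists N, forall n, (N <= n)%N ->
    (2 * ln (class_number G n)%:R + m) / (n%:R * c) <= e.
Proof.
move=> c0 e0; have k0 : 0 < e * c / 4 by rewrite divr_gt0// mulr_gt0.
have [N NP] := poly_le_exp #|{: G}|.+1 #|{: G}|.+1 k0.
exists (N + (Num.trunc (2 * m / (e * c))).+1)%N => n Nn.
have n1 : (N <= n)%N by apply: leq_trans Nn; rewrite leq_addr.
have n2 : ((Num.trunc (2 * m / (e * c))).+1 <= n)%N by apply: leq_trans Nn; rewrite leq_addl.
have n0 : (0 < n)%N by apply: leq_trans n2.
have lnT : ln (class_number G n)%:R <= n%:R * (e * c / 4).
  rewrite -ler_expR lnK ?posrE ?ltr0n ?muln_gt0 ?expn_gt0//.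
  by apply: le_trans (NP _ n1); rewrite ler_nat class_number_le.
have mn : 2 * m / (e * c) <= n%:R.
  by apply: le_trans (ltW (truncnS_gt _)) _; rewrite ler_nat.
rewrite ler_pdivrMr ?mulr_gt0// in mn.
rewrite ler_pdivrMr ?mulr_gt0 ?ltr0n//.
have -> : e * (n%:R * c) = n%:R * (e * c) by ring.
by move: lnT; rewrite mulrA; lra.
Qed.

End limit.

Theorem theorem1p1 (R : realType) (G : {fset diagonal_map R})
    (Lambda : set (R * R))
    (G_carpet : self_affine_carpet G)
    (G_attractor : is_attractor G Lambda)
    (G_normalized : normalized Lambda)
    (G_orientation : orientation_preserving G)
    (G_cases :
      (weak_separation (projected1 G) /\ weak_separation (projected2 G)) \/
      [/\ coordinate_ordering G, rectangular_osc G
        & weak_separation (projected2 G)]) :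
  (H_BA (n_fold G n))%:E @[n --> \oo] --> hausdorff_dim Lambda.

Proof.
have meas0 n s : (0 < n)%N -> 0 <= s -> H_BA (n_fold G n) < s ->
    hausdorff_measure s Lambda = 0%E.
  move=> n0 s0 Hs.
  apply: (hausdorff_measure_eq0 G_orientation G_carpet G_attractor G_normalized n0 s0 Hs).
  by case: (H_BA_n_fold G_orientation G_carpet G_attractor G_normalized n0).
have H0 n : (0 < n)%N -> 0 <= H_BA (n_fold G n).
  move=> n0; have [[p pp <-] _] := H_BA_n_fold G_orientation G_carpet G_attractor G_normalized n0.
  by apply: D_BA_ge0 => // S b;
    exact: (n_fold_ratio G_orientation G_carpet G_attractor G_normalized b n0).
have dim_le n : (0 < n)%N -> (hausdorff_dim Lambda <= (H_BA (n_fold G n))%:E)%E.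
  move=> n0; apply/lee_addgt0Pr => e e0; apply: ereal_inf_lbound.
  exists (H_BA (n_fold G n) + e) => //.
  have He0 : 0 <= H_BA (n_fold G n) + e by rewrite addr_ge0 ?H0// ltW.
  by split=> //; apply: (meas0 n) => //; rewrite ltrDl.
have dim_ge0 : (0 <= hausdorff_dim Lambda)%E.
  by apply: le_ereal_inf_tmp => _ [s [s0 _] <-]; rewrite lee_fin.
have [m [c [c0 HP]]] := H_BA_le G_orientation G_carpet G_attractor G_normalized G_cases.
have dim_ge n : (0 < n)%N -> ((H_BA (n_fold G n) -
    (2 * ln (class_number G n)%:R + m) / (n%:R * c))%:E <= hausdorff_dim Lambda)%E.
  move=> n0; apply: le_ereal_inf_tmp => _ [s [s0 Hs] <-].
  by rewrite lee_fin lerBlDr HP.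
(* The value +oo is excluded by the upper bound at n = 1, and -oo by nonnegativity. *)
move: dim_ge0 dim_le dim_ge; case: (hausdorff_dim Lambda) => [d| |] d0 dim_le dim_ge.
- apply: cvg_EFin; first by near=> n.
  apply/cvgrPdist_le => e e0 /=.
  have [N NP] := class_number_error G m c0 e0.
  near=> n.
  have n0 : (0 < n)%N by near: n; exists 1%N.
  have Nn : (N <= n)%N by near: n; exists N.
  have := dim_le n n0; have := dim_ge n n0; have := NP n Nn; rewrite !lee_fin.
  move=> h1 h2 h3; rewrite distrC ger0_norm; lra.
- by have := dim_le 1%N isT.
- by [].
Unshelve. all: by end_near.
Qed.
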